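(* Let $d\ge 1$, $m\ge 2$, let $\mu_0,\mu_1$ be probability measures on $\mathbb{Z}_m^d$, $\pi\in\Pi(\mu_0,\mu_1)$ a coupling, and let the base process be either the nearest-neighbor random walk (NNRW) or the uniform random walk (URW), with the associated jump operators $\mathcal{M}$, jump rate $\lambda(m)$, interpolant $X^{\mathrm I}$ and rates $q^{\mathrm M}_t$ defined in the context. Let $\mathrm{C}(m)=1$ for URW and $\mathrm{C}(m)=m$ for NNRW. Let $\eta\in(0,1)$ be the early-stopping parameter and let $\{t_k\}_{k=0}^K$ be the time-discretization of $[0,1-\eta]$ given by $t_k=1-(1+h)^{-k}$, where $h\in(0,1)$ (so that $t_0=0$ and $t_K=1-\eta$), and let $h_{k+1}=t_{k+1}-t_k$. Let $u^{\mathrm M,\theta^\star}:[0,1]\times(\mathbb{Z}_m^d)^2\to\mathbb{R}_+$ be an approximate score, $q^{\mathrm M,\theta^\star}_t(x,y)=q(x,y)\,u^{\mathrm M,\theta^\star}_t(x,y)$, and let $X^{\theta^\star}$ be the associated generative process defined in the context. Assume that for some $\tilde\varepsilon\ge 0$, $$\sum_{k=0}^{K-1}h_{k+1}\,\mathbb{E}\Big[\sum_{\sigma\in\mathcal{M}}\Big\{q^{\mathrm M,\theta^\star}_{t_k}\,\varphi\Big(\frac{q^{\mathrm M}_{t_k}}{q^{\mathrm M,\theta^\star}_{t_k}}\Big)+\big(q^{\mathrm M,\theta^\star}_{t_k}-q^{\mathrm M}_{t_k}\big)^2\Big\}\big(X^{\mathrm I}_{t_k},\sigma(X^{\mathrm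 I}_{t_k})\big)\Big]\le\tilde\varepsilon^2 ,$$ where $\varphi(a)=a\log a+1-a$ for $a\ge0$. Then, for both NNRW and URW, there is a universal constant $C_0>0$ such that $$\big\|\mathrm{Law}(X^{\theta^\star}_{1-\eta})-\mu_1\big\|_{\mathrm{TV}}\le C_0\Big[\mathrm{C}(m)\,d\,\eta+m\eta^{-1}\sqrt{\sqrt{|\mathcal{M}|}\,\tilde\varepsilon+\tilde\varepsilon^2}+\lambda(m)\,d\,m\sqrt{h\log(m\eta^{-1})\log(\eta^{-1})}\Big].$$
   Context: $\mathbb{Z}_m^d=\{0,\dots,m-1\}^d$ (coordinatewise arithmetic mod $m$). $\Pi(\mu_0,\mu_1)$: couplings of $\mu_0,\mu_1$. $\|\cdot\|_{\mathrm{TV}}$ is the total variation distance. A universal constant is one independent of all parameters and data of the problem. Base processes: homogeneous continuous-time Markov chains on $\mathbb{Z}_m^d$ with generator $q$, a finite collection $\mathcal{M}$ of jump operators $\sigma:\mathbb{Z}_m^d\to\mathbb{Z}_m^d$ and jump rate $\lambda(m)$: each $\sigma\in\mathcal{M}$ is applied at rate $q(x,\sigma(x))=\lambda(m)$, there are no other jumps, and $q(x,x)=-\lambda(m)|\mathcal{M}|$. - NNRW: $\mathcal{M}=\{\sigma^\ell_+,\sigma^\ell_-\}_{\ell=1}^d$, $\sigma^\ell_\pm(x)=x\pm e_\ell \pmod m$; $\lambda(m)=1/2$, $q(x,x)=-d$. The coordinates are independent, each displacement over a time $t$ being $N^+_t-N^-_t \pmod m$ with $N^\pm_t$ independent Poisson($t/2$),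 i.e. $p_{t+s|s}(y|x)=\prod_{i=1}^d\sum_{k\in\mathbb{Z}}e^{-t}I_{|y^i-x^i+km|}(t)$, with $I_b$ the modified Bessel function of the first kind. (If $m=2$, $\sigma^\ell_+$ and $\sigma^\ell_-$ are counted as two jump operators, each of rate $1/2$.) - URW: $\mathcal{M}=\{\sigma^\ell_n:\ell\in\{1,\dots,d\},\,n\in\{1,\dots,m-1\}\}$, $\sigma^\ell_n(x)=x+ne_\ell\pmod m$; $\lambda(m)=1/m$, $q(x,x)=-d(m-1)/m$. $p_{t|s}(y|x)$, $0\le s\le t\le 1$, are the transition probabilities of the base process. Put $\tilde\pi(x_0,x_1)=\pi(x_0,x_1)/p_{1|0}(x_1|x_0)$. Interpolant: $(X^{\mathrm I}_0,X^{\mathrm I}_1)\sim\pi$ and, given $(X^{\mathrm I}_0,X^{\mathrm I}_1)=(x_0,x_1)$, $(X^{\mathrm I}_t)_{t\in[0,1]}$ has the law of the base process conditioned to start at $x_0$ and end at $x_1$. Its time marginals are $p^{\mathrm I}_t(x)=\sum_{x_0,x_1}p_{t|0}(x|x_0)p_{1|t}(x_1|x)\tilde\pi(x_0,x_1)$. Score and projected rates: $$u^{\mathrm M}_t(x,y)=\frac{\sum_{x_0,x_1}p_{1|t}(x_1|y)\,p_{t|0}(x|x_0)\,\tilde\pi(x_0,x_1)}{p^{\mathrm I}_t(x)},\qquad q^{\mathrm M}_t(x,y)=q(x,y)\,u^{\mathrm M}_t(x,y)\ (x\ne y),$$ so $q^{\mathrm M}_t(x,\sigma(x))=\lambda(m)u^{\mathrm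 M}_t(x,\sigma(x))$ and $q^{\mathrm M,\theta^\star}_t(x,\sigma(x))=\lambda(m)u^{\mathrm M,\theta^\star}_t(x,\sigma(x))$ for $\sigma\in\mathcal{M}$. Here $b\,\varphi(a/b)=a\log(a/b)-a+b$, with the usual conventions when $a$ or $b$ vanishes ($+\infty$ if $b=0<a$, $0$ if $a=b=0$). Generative process: $X^{\theta^\star}_0\sim\mu_0$; for each $k$, given $X^{\theta^\star}_{t_k}$, on $[t_k,t_{k+1})$ the process jumps from any current state $x$ to $\sigma(x)$, $\sigma\in\mathcal{M}$, at the constant rate $\lambda(m)\,u^{\mathrm M,\theta^\star}_{t_k}(X^{\theta^\star}_{t_k},\sigma(X^{\theta^\star}_{t_k}))$ (rates frozen at the state occupied at time $t_k$), and has no other jumps. It is stopped at $t_K=1-\eta$. *)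

(* Defs.v *)
From HB Require Import structures.
From mathcomp Require Import all_boot all_order all_algebra.
From mathcomp Require Import all_classical all_reals all_analysis.
Set Implicit Arguments.
Unset Strict Implicit.
Unset Printing Implicit Defensive.
Import Order.TTheory GRing.Theory Num.Theory.
Import numFieldNormedType.Exports.
Local Open Scope classical_set_scope.
Local Open Scope ring_scope.

Inductive walk := NNRW | URW.

(* The torus (Z/mZ)^d.  'Z_m has m elements only for 1 < m. *)
Notation state d m := 'rV['Z_m]_d.

(* The index type of the family M of jump operators.  NNRW has 2d operators,
   also for m = 2, where the two operators (l, true) and (l, false) act in the
   same way but are counted separately; URW has d(m-1) operators. *)
Definition jump (w : walk) (d m : nat) : finType :=
  match w with
  | NNRW => ('I_d * bool)%type
  | URW => ('I_d * {n : 'Z_m | n != 0})%type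
  end.

Definition move (w : walk) (d m : nat) : jump w d m -> state d m -> state d m :=
  match w return jump w d m -> state d m -> state d m with
  | NNRW => fun s x => if s.2 then x + delta_mx 0 s.1 else x - delta_mx 0 s.1
  | URW => fun s x => x + val s.2 *: delta_mx 0 s.1
  end.

(* lambda(m) *)
Definition rate (R : realType) (w : walk) (m : nat) : R :=
  match w with NNRW => 2^-1 | URW => m%:R^-1 end.

(* C(m) *)
Definition Cwalk (R : realType) (w : walk) (m : nat) : R :=
  match w with NNRW => m%:R | URW => 1 end.

Definition expmx (R : realType) (n : nat) (A : 'M[R]_n) : 'M[R]_n :=
  \matrix_(i, j) limn (series (fun k : nat => (A ^+ k) i j / k`!%:R)).

(* Generator of the homogeneous Markov chain applying the operator s at rate
   r s: the rates of operators with the same effect add up, and the diagonal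
   entry is minus the total rate. *)
Definition generator (R : realType) (w : walk) (d m : nat)
    (r : jump w d m -> R) : 'M[R]_#|{: state d m}| :=
  \matrix_(i, j) \sum_(s : jump w d m)
    r s * ((move s (enum_val i) == enum_val j)%:R - (i == j)%:R).

(* Probability of being in y at time t when started from x at time 0. *)
Definition transition (R : realType) (w : walk) (d m : nat)
    (r : jump w d m -> R) (t : R) (x y : state d m) : R :=
  expmx (t *: generator r) (enum_rank x) (enum_rank y).

(* p_{t+s|s}(y|x), which does not depend on s *)
Definition ptrans (R : realType) (w : walk) (d m : nat)
    (t : R) (x y : state d m) : R :=
  transition (fun _ : jump w d m => rate R w m) t x y.

Definition is_pmf (R : realType) (T : finType) (mu : T -> R) :=
  (forall x, 0 <= mu x) /\ \sum_x mu x = 1.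

Definition is_coupling (R : realType) (T : finType) (mu0 mu1 : T -> R)
    (pi : T -> T -> R) :=
  [/\ forall x y, 0 <= pi x y,
      forall x, \sum_y pi x y = mu0 x &
      forall y, \sum_x pi x y = mu1 y].

Definition tvdist (R : realType) (T : finType) (mu nu : T -> R) : R :=
  2^-1 * \sum_x `|mu x - nu x|.

Definition law (R : realType) (disp : measure_display)
    (Om : measurableType disp) (P : probability Om R) (T : Type)
    (X : Om -> T) (x : T) : R := fine (P (X @^-1` [set x])).

Definition cylinder (R : realType) (Om : Type) (T : eqType) (X : R -> Om -> T)
    (l : seq (R * T)) : set Om :=
  [set om | forall a, a \in l -> X a.1 om = a.2].

Section Interpolant.
Variables (R : realType) (w : walk) (d m : nat).
Notation S := (state d m).
Notation p := (ptrans w).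

(* Probability that the base process, in x at time s, visits the successive
   space-time points of l. *)
Fixpoint path_prob (s : R) (x : S) (l : seq (R * S)) : R :=
  if l is (t, y) :: l' then p (t - s) x y * path_prob t y l' else 1.

(* The finite-dimensional laws: the endpoints have joint law pi and, given
   these, the intermediate values follow the base process conditioned on its
   endpoints. *)
Definition is_interpolant (disp : measure_display) (Om : measurableType disp)
    (P : probability Om R) (X : R -> Om -> S) (pi : S -> S -> R) :=
  (forall (t : R) (x : S), 0 <= t <= 1 -> measurable (X t @^-1` [set x])) /\
  (forall (x0 x1 : S) (l : seq (R * S)),
     sorted <=%R (0 :: rcons [seq a.1 | a <- l] 1) ->
     P (cylinder X ((0, x0) :: rcons l (1, x1))) =
       (pi x0 x1 *
        (path_prob 0 x0 (rcons l (1, x1)) / p 1 x0 x1))%:E).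

Definition pitilde (pi : S -> S -> R) (x0 x1 : S) : R :=
  pi x0 x1 / p 1 x0 x1.

Definition pI (pi : S -> S -> R) (t : R) (x : S) : R :=
  \sum_x0 \sum_x1 p t x0 x * p (1 - t) x x1 * pitilde pi x0 x1.

Definition uM (pi : S -> S -> R) (t : R) (x y : S) : R :=
  (\sum_x0 \sum_x1 p (1 - t) y x1 * p t x0 x * pitilde pi x0 x1) / pI pi t x.

End Interpolant.

(* q_t(x, s(x)) for a score u, per jump operator s *)
Definition qjump (R : realType) (w : walk) (d m : nat)
    (u : R -> state d m -> state d m -> R) (t : R) (x : state d m)
    (s : jump w d m) : R := rate R w m * u t x (move s x).

Definition grid (R : realType) (h : R) (k : nat) : R := 1 - (1 + h) ^- k.

(* X starts from mu0 and, on [t_k, t_(k+1)], given its past up to time t_k, it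
   is the Markov chain whose rates are frozen at the state z occupied at t_k.
   The finite list l ranges over the histories up to time s. *)
Definition is_generative (R : realType) (w : walk) (d m : nat)
    (disp : measure_display) (Om : measurableType disp)
    (P : probability Om R) (X : R -> Om -> state d m)
    (mu0 : state d m -> R) (u : R -> state d m -> state d m -> R)
    (h : R) (K : nat) :=
  [/\ forall (t : R) (x : state d m),
        0 <= t <= grid h K -> measurable (X t @^-1` [set x]),
      forall x, P (X 0 @^-1` [set x]) = (mu0 x)%:E &
      forall (k : nat) (s s' : R) (z x y : state d m)
          (l : seq (R * state d m)),
        (k < K)%N -> grid h k <= s -> s <= s' -> s' <= grid h k.+1 ->
        (forall a : R * state d m, a \in l -> 0 <= a.1 <= s) ->
        P (cylinder X [:: (s', y), (s, x), (grid h k, z) & l]) =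
          (P (cylinder X [:: (s, x), (grid h k, z) & l]) *
           (transition (qjump (w := w) u (grid h k) z) (s' - s) x y)%:E)%E].

Definition phi (R : realType) (a : R) : R := a * ln a + 1 - a.

(* b phi(a/b), with value +oo when b = 0 < a and 0 when a = b = 0;
   ln 0 = 0, so that phi 0 = 1. *)
Definition bphi (R : realType) (a b : R) : \bar R :=
  if b == 0 then (if a == 0 then 0%E else +oo%E) else (b * phi (a / b))%:E.

(* The integrand is extended-real valued because of bphi; it is never -oo. *)
Definition score_error (R : realType) (w : walk) (d m : nat)
    (disp : measure_display) (Om : measurableType disp)
    (P : probability Om R) (X : R -> Om -> state d m)
    (pi : state d m -> state d m -> R)
    (u : R -> state d m -> state d m -> R) (h : R) (K : nat) : \bar R :=
  (\sum_(0 <= k < K) (grid h k.+1 - grid h k)%:E *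
     \int[P]_om (\sum_(s : jump w d m)
       let q := qjump (uM w pi) (grid h k) (X (grid h k) om) s in
       let q' := qjump u (grid h k) (X (grid h k) om) s in
       (bphi q q' + ((q' - q) ^+ 2)%:E))%E)%E.

(* Main.v *)
(* Total variation is bounded without path measures, by matrix exponentials.
   Writing A for lambda(m) times the sum of the translations by the jumps and L
   for the total rate, the base process is e^(t(A - L)), and the one estimate on
   it is s A e^(sA) <= D e^(sA) entrywise for s <= 1, with D = 4 C(m) d: given
   both endpoints, the base process makes at most D jumps on average.  Hence the
   interpolant moves on [1 - eta, 1] with probability at most eta D.
   On a grid interval of length delta, the bridge and the frozen chain both
   agree with their first-order Euler steps up to the probability of two jumps,
   which is O(delta^2 D^2) and O((delta J)^2) for J the total jump rate at t_k;
   here delta J <= h D because delta <= h (1 - t_k).  The two Euler steps differ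
   by the rate errors.  Summing over the grid gives an error linear in h D^2 and
   in the L^1 score error; since TV <= 1, both may be replaced by their square
   roots. *)
Require Import Defs.
From mathcomp Require Import all_boot all_order all_algebra.
From mathcomp Require Import all_classical all_reals all_analysis.
From mathcomp Require Import measurable_realfun.
From mathcomp Require Import ring lra.
Set Implicit Arguments.
Unset Strict Implicit.
Unset Printing Implicit Defensive.
Import Order.TTheory GRing.Theory Num.Theory.
Import numFieldNormedType.Exports.
Local Open Scope classical_set_scope.
Local Open Scope ring_scope.

(** The obstacle is the blow-up of the bridge rates, of order D / (1 - t), as t tends to 1.
    Second-order terms are therefore not all bounded pointwise. Averaging over the position of the
    bridge turns, by Chapman-Kolmogorov, a jump count with 1 - t to go into the same count over the
    whole of [0, 1], which is at most D, or D^2 for pairs of jumps. Matrix inequalities are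
    entrywise and come from power series with nonnegative terms, the scalar e^(-tL) being split off
    for this purpose. They are one-sided; they become L^1 bounds when both sides have the same mass.
    The value of C(m) reflects a bridge with little time left: along one axis NNRW may still have to
    make a number of jumps of order m, URW only one. The factor sqrt |M| comes from Cauchy-Schwarz
    over the jumps, and the logarithms enter through ln (1 / eta) >= 1 - eta, the length of the
    grid, and ln (m / eta) >= 1/2. *)

(** The pairs [(k - j, j)] with [j <= k < N] run exactly once through the triangle [i + j < N] of
    the square. *)
Lemma sum_square_triangle (V : zmodType) (F : nat -> nat -> V) N :
  \sum_(0 <= i < N) \sum_(0 <= j < N) F i j
    - \sum_(0 <= k < N) \sum_(0 <= j < k.+1) F (k - j)%N j =
  \sum_(0 <= i < N) \sum_(0 <= j < N | (N <= i + j)%N) F i j.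
Proof.
have -> : \sum_(0 <= k < N) \sum_(0 <= j < k.+1) F (k - j)%N j =
    \sum_(0 <= i < N) \sum_(0 <= j < N | (i + j < N)%N) F i j.
  transitivity (\sum_(0 <= k < N) \sum_(0 <= j < N | (j <= k)%N) F (k - j)%N j).
    apply: eq_big_nat => k /andP[_ kN].
    rewrite [RHS](big_cat_nat (n := k.+1)) //=.
    rewrite [X in _ = _ + X]big1_seq ?addr0; last first.
      by move=> j; rewrite mem_index_iota => /and3P[jk kj _]; rewrite leqNgt kj in jk.
    by rewrite big_nat [RHS]big_nat_cond; apply: eq_bigl => j; case: (ltnP j k.+1).
  rewrite (exchange_big_dep_nat xpredT) //=.
  rewrite [RHS](exchange_big_dep_nat xpredT) //=.
  apply: eq_big_nat => j /andP[_ jN].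
  rewrite (big_cat_nat (n := j)) ?(ltnW jN) //= big1_seq ?add0r; last first.
    by move=> i; rewrite mem_index_iota => /and3P[ji _ ij]; rewrite leqNgt ij in ji.
  rewrite -{1}[j]add0n big_addn.
  rewrite [RHS](big_cat_nat (n := (N - j)%N)) ?leq_subr //=.
  rewrite [X in _ = _ + X]big1_seq ?addr0; last first.
    move=> i; rewrite mem_index_iota => /andP[ijN /andP[ij _]].
    by move: ij; rewrite leq_subLR addnC leqNgt ijN.
  rewrite big_nat_cond [RHS]big_nat_cond; apply: eq_big => [i|i _]; last by rewrite addnK.
  by rewrite leq_addl andbT ltn_subRL addnC; case: (i + j < N)%N; rewrite ?andbF ?andbT.
rewrite -sumrB; apply: eq_big_nat => i _.
apply/eqP; rewrite subr_eq addrC; apply/eqP.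
rewrite (bigID (fun j => (i + j < N)%N)) /=; congr (_ + _).
by apply: eq_bigl => j; rewrite -leqNgt.
Qed.

(** * Matrix exponential *)

Section ExpMatrix.
Context {R : realType} {n : nat}.
Implicit Types A B G : 'M[R]_n.

Definition lemx A B := forall i j, A i j <= B i j.

Lemma lemx_refl A : lemx A A. Proof. by []. Qed.

Lemma lemx_trans B A G : lemx A B -> lemx B G -> lemx A G.
Proof. by move=> AB BG i j; exact: le_trans (AB i j) (BG i j). Qed.

Lemma lemxD A B A' B' : lemx A A' -> lemx B B' -> lemx (A + B) (A' + B').
Proof. by move=> h h' i j; rewrite !mxE lerD. Qed.

Lemma lemxZ (a : R) A B : 0 <= a -> lemx A B -> lemx (a *: A) (a *: B).
Proof. by move=> a0 h i j; rewrite !mxE ler_wpM2l. Qed.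

Lemma lemxM A B A' B' :
  lemx 0 A -> lemx A A' -> lemx 0 B -> lemx B B' -> lemx (A * B) (A' * B').
Proof.
move=> A0 AA' B0 BB' i j; rewrite !mxE ler_sum // => k _.
by move: (A0 i k) (B0 k j); rewrite !mxE => ? ?; rewrite ler_pM.
Qed.

Lemma lemx_sum (I : finType) (P : pred I) (F F' : I -> 'M[R]_n) :
  (forall s, P s -> lemx (F s) (F' s)) ->
  lemx (\sum_(s | P s) F s) (\sum_(s | P s) F' s).
Proof. by move=> h i j; rewrite !summxE ler_sum // => s Ps; exact: h. Qed.

Lemma mulmx_ge0 A B : lemx 0 A -> lemx 0 B -> lemx 0 (A * B).
Proof.
move=> A0 B0 i j; rewrite !mxE sumr_ge0 // => k _.
by move: (A0 i k) (B0 k j); rewrite !mxE => *; rewrite mulr_ge0.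
Qed.

Lemma scalemx_ge0 (a : R) A : 0 <= a -> lemx 0 A -> lemx 0 (a *: A).
Proof. by move=> a0 h i j; move: (h i j); rewrite !mxE => ?; rewrite mulr_ge0. Qed.

Lemma summx_ge0 (I : finType) (P : pred I) (F : I -> 'M[R]_n) :
  (forall s, P s -> lemx 0 (F s)) -> lemx 0 (\sum_(s | P s) F s).
Proof.
move=> h i j; rewrite summxE mxE sumr_ge0 // => s Ps.
by move: (h s Ps i j); rewrite mxE.
Qed.

Lemma onemx_ge0 : lemx 0 (1 : 'M[R]_n).
Proof. by move=> i j; rewrite !mxE ler0n. Qed.

Lemma powmx_ge0 A k : lemx 0 A -> lemx 0 (A ^+ k).
Proof.
move=> A0; elim: k => [|k IH]; first exact: onemx_ge0.
by rewrite exprS; exact: mulmx_ge0.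
Qed.

Definition mxcvg (U : nat -> 'M[R]_n) A :=
  forall i j, U N i j @[N --> \oo] --> A i j.

Lemma mxcvg_cst A : mxcvg (fun=> A) A.
Proof. by move=> i j; exact: cvg_cst. Qed.

Lemma mxcvgM U V A B :
  mxcvg U A -> mxcvg V B -> mxcvg (fun N => U N * V N) (A * B).
Proof.
move=> UA VB i j; rewrite mxE.
under eq_fun do rewrite mxE.
apply: cvg_big => [|k _]; first exact: add_continuous.
exact: cvgM.
Qed.

Lemma mxcvg_le U V A B :
  mxcvg U A -> mxcvg V B -> (forall N, lemx (U N) (V N)) -> lemx A B.
Proof.
move=> UA VB UV i j; apply: (ler_cvg_to (UA i j) (VB i j)).
by near=> N; exact: UV.
Unshelve. all: by end_near. Qed.

Lemma mxcvg_unique U A B : mxcvg U A -> mxcvg U B -> A = B.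
Proof. by move=> UA UB; apply/matrixP => i j; exact: (cvg_unique _ (UA i j) (UB i j)). Qed.

Definition expsum A N : 'M[R]_n := \sum_(0 <= k < N) k`!%:R^-1 *: A ^+ k.

Definition mxnorm1 A : R := \sum_i \sum_j `|A i j|.

Lemma mxnorm1_ge0 A : 0 <= mxnorm1 A.
Proof. by apply: sumr_ge0 => i _; apply: sumr_ge0. Qed.

(** Each row of absolute values sums to at most [mxnorm1 A], so every further power costs one such
    factor. *)
Lemma le_pow_mxnorm1 A k i j : `|(A ^+ k) i j| <= mxnorm1 A ^+ k.
Proof.
elim: k i j => [|k IH] i j; first by rewrite !expr0 mxE; case: eqP; rewrite ?normr1 ?normr0.
rewrite exprS mxE (le_trans (ler_norm_sum _ _ _)) //.
have le_row : \sum_l `|A i l| <= mxnorm1 A.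
  by rewrite /mxnorm1 [leRHS](bigD1 i) //= lerDl sumr_ge0 // => ? _; rewrite sumr_ge0.
rewrite exprS; apply: le_trans (ler_wpM2r (exprn_ge0 _ (mxnorm1_ge0 A)) le_row).
by rewrite mulr_suml ler_sum // => l _; rewrite normrM ler_wpM2l.
Qed.

Lemma expsumE A N i j :
  expsum A N i j = series (fun k => (A ^+ k) i j / k`!%:R) N.
Proof.
rewrite /expsum summxE /series /=; apply: eq_bigr => k _.
by rewrite mxE mulrC.
Qed.

Lemma cvg_expmx A : mxcvg (expsum A) (expmx A).
Proof.
move=> i j; rewrite mxE; under eq_fun do rewrite expsumE.
suff : cvgn (series (fun k => (A ^+ k) i j / k`!%:R)) by [].
apply: normed_cvg; apply: (series_le_cvg _ _ _ (is_cvg_series_exp_coeff (mxnorm1 A))) => k.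
- exact: normr_ge0.
- by rewrite /exp_coeff /= mulr_ge0 ?exprn_ge0 ?mxnorm1_ge0 ?invr_ge0.
- rewrite /exp_coeff /= normrM [`|_^-1|]ger0_norm ?invr_ge0//.
  by rewrite ler_wpM2r ?invr_ge0 // le_pow_mxnorm1.
Qed.

End ExpMatrix.
Arguments cvg_expmx {R n} A i j.
Arguments powmx_ge0 {R n A} k A0 i j.
Arguments mxcvgM {R n U V A B} UA VB i j.

(** Serves matrices and real numbers alike: the two remainders then have the same index set and can
    be compared term by term. *)
Lemma cauchy_remainder (V : pzRingType) (X Y Z : nat -> V) N :
  (forall k, Z k = \sum_(0 <= j < k.+1) X (k - j)%N * Y j) ->
  (\sum_(0 <= i < N) X i) * (\sum_(0 <= j < N) Y j) - \sum_(0 <= k < N) Z k =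
  \sum_(0 <= i < N) \sum_(0 <= j < N | (N <= i + j)%N) X i * Y j.
Proof.
move=> ZE; rewrite -sum_square_triangle; congr (_ - _).
  by rewrite mulr_suml; apply: eq_bigr => i _; rewrite mulr_sumr.
by apply: eq_bigr => k _; exact: ZE.
Qed.

Lemma fact_binV (F : numFieldType) k j : (j <= k)%N ->
  k`!%:R^-1 *+ 'C(k, j) = (k - j)`!%:R^-1 * j`!%:R^-1 :> F.
Proof.
move=> jk; rewrite -(bin_fact jk) !natrM -mulr_natl; field.
by rewrite !pnatr_eq0 -!lt0n !fact_gt0 bin_gt0 jk.
Qed.

Section ExpMatrixTheory.
Context {R : realType} {n : nat}.
Implicit Types A B G : 'M[R]_n.

Lemma mulmxZl (c : R) A B : (c *: A) * B = c *: (A * B).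
Proof. by rewrite -[LHS]/(_ *m _) -scalemxAl. Qed.

Lemma mulmxZr (c : R) A B : A * (c *: B) = c *: (A * B).
Proof. by rewrite -[LHS]/(_ *m _) -scalemxAr. Qed.

Lemma expsum_comm_remainder A B N : GRing.comm A B ->
  expsum A N * expsum B N - expsum (A + B) N =
  \sum_(0 <= i < N) \sum_(0 <= j < N | (N <= i + j)%N)
    (i`!%:R^-1 *: A ^+ i) * (j`!%:R^-1 *: B ^+ j).
Proof.
move=> cAB; apply: cauchy_remainder => k.
rewrite exprDn_comm // scaler_sumr big_mkord; apply: eq_bigr => -[j /= jk] _.
rewrite -scalerMnr scalerMnl fact_binV //.
by rewrite mulmxZl mulmxZr scalerA.
Qed.

Lemma exp_remainder (a b : R) N :
  series (exp_coeff a) N * series (exp_coeff b) N - series (exp_coeff (a + b)) N =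
  \sum_(0 <= i < N) \sum_(0 <= j < N | (N <= i + j)%N)
    exp_coeff a i * exp_coeff b j.
Proof.
apply: cauchy_remainder => k.
rewrite /exp_coeff /= exprDn mulr_suml big_mkord; apply: eq_bigr => -[j /= jk] _.
rewrite mulrnAl -mulrnAr fact_binV //; ring.
Qed.

Lemma cvg_series_expR (a : R) : series (exp_coeff a) N @[N --> \oo] --> expR a.
Proof. exact: is_cvg_series_exp_coeff. Qed.

(** Entry by entry, the remainder of the truncated Cauchy product is dominated by that of the real
    exponentials of the norms, which tends to 0 because [expR (a + b) = expR a * expR b]. *)
Lemma expmxD A B : GRing.comm A B -> expmx (A + B) = expmx A * expmx B.
Proof.
move=> cAB; apply: (@mxcvg_unique _ _ (expsum (A + B))); first exact: cvg_expmx.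
move=> i j.
pose a := mxnorm1 A; pose b := mxnorm1 B.
(* The factor [n] counts the intermediate indices in an entry of a product of two matrices. *)
pose r N := n%:R * (series (exp_coeff a) N * series (exp_coeff b) N
                    - series (exp_coeff (a + b)) N).
have r0 : r N @[N --> \oo] --> (0 : R).
  rewrite -[X in _ --> X](mulr0 (n%:R : R)); apply: cvgM; first exact: cvg_cst.
  rewrite -(subrr (expR (a + b))) {1}expRD; apply: cvgB; last exact: cvg_series_expR.
  by apply: cvgM; exact: cvg_series_expR.
pose U N : R := (expsum A N * expsum B N) i j.
have UE : U N @[N --> \oo] --> (expmx A * expmx B) i j.
  exact: (mxcvgM (cvg_expmx A) (cvg_expmx B) i j).
have le_r N : `|U N - expsum (A + B) N i j| <= r N.
  have -> : U N - expsum (A + B) N i j = (expsum A N * expsum B N - expsum (A + B) N) i j.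
    by rewrite /U; move: (expsum A N * expsum B N) => X; rewrite !mxE.
  rewrite expsum_comm_remainder // /r exp_remainder summxE mulr_sumr.
  rewrite (le_trans (ler_norm_sum _ _ _)) // ler_sum // => k _.
  rewrite summxE mulr_sumr (le_trans (ler_norm_sum _ _ _)) //.
  apply: ler_sum => l _; rewrite mxE (le_trans (ler_norm_sum _ _ _)) //.
  have -> : n%:R * (exp_coeff a k * exp_coeff b l) = \sum_(s < n) exp_coeff a k * exp_coeff b l.
    by rewrite sumr_const card_ord mulr_natl.
  apply: ler_sum => s _.
  rewrite normrM !mxE !normrM ![`|_^-1|]ger0_norm ?invr_ge0//.
  rewrite /exp_coeff /= ![_ / _]mulrC ler_pM ?mulr_ge0 ?invr_ge0//;
    by rewrite ler_wpM2l ?invr_ge0// le_pow_mxnorm1.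
apply: (@squeeze_cvgr _ _ _ _ (fun N => U N - r N) (fun N => U N + r N)).
- near=> N; have := le_r N; rewrite ler_norml => /andP[h1 h2].
  by apply/andP; split; lra.
- by rewrite -[X in _ --> X]subr0; apply: cvgB.
- by rewrite -[X in _ --> X]addr0; apply: cvgD.
Unshelve. all: by end_near. Qed.

Lemma expmx_scalar (a : R) : expmx (a%:M : 'M[R]_n) = (expR a)%:M.
Proof.
apply: mxcvg_unique (cvg_expmx _) _ => i j.
have -> : (expR a)%:M i j = expR a * (i == j)%:R :> R by rewrite mxE mulr_natr.
have -> : (fun N => expsum (a%:M : 'M[R]_n) N i j) =
          (fun N => series (exp_coeff a) N * (i == j)%:R).
  apply/funext => N; rewrite /expsum summxE /series /= mulr_suml.
  apply: eq_bigr => k _.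
  have -> : (a%:M : 'M[R]_n) ^+ k = (a ^+ k)%:M.
    elim: k => [|k IH]; first by rewrite !expr0.
    by rewrite !exprS IH -[LHS]/(_ *m _) -scalar_mxM.
  by rewrite !mxE /exp_coeff /= -[a ^+ k *+ _]mulr_natr; ring.
by apply: cvgM; [exact: cvg_series_expR | exact: cvg_cst].
Qed.

Lemma expmx_comm A B : GRing.comm A B -> GRing.comm (expmx A) B.
Proof.
move=> cAB; apply: (@mxcvg_unique _ _ (fun N => expsum A N * B)).
  by apply: mxcvgM; [exact: cvg_expmx | exact: mxcvg_cst].
have -> : (fun N => expsum A N * B) = (fun N => B * expsum A N).
  apply/funext => N; rewrite /expsum mulr_suml mulr_sumr; apply: eq_bigr => k _.
  rewrite mulmxZl mulmxZr; congr (_ *: _).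
  by apply: commr_sym; exact: commrX.
by apply: mxcvgM; [exact: mxcvg_cst | exact: cvg_expmx].
Qed.

Section Nonneg.
Variable A : 'M[R]_n.
Hypothesis A0 : lemx 0 A.

Lemma expsum_ge0 N : lemx 0 (expsum A N).
Proof.
move=> i j; rewrite /expsum summxE mxE sumr_ge0 // => k _.
have /(_ i j) := powmx_ge0 k A0.
by rewrite !mxE => ?; rewrite mulr_ge0 ?invr_ge0.
Qed.

Lemma expsum_le_expmx N : lemx (expsum A N) (expmx A).
Proof.
move=> i j; apply: (cvgr_to_ge (cvg_expmx A i j)).
near=> M; have NM : (N <= M)%N by near: M; exact: nbhs_infty_ge.
rewrite /expsum [in leRHS](big_cat_nat (leq0n _) NM) //= [leRHS]mxE lerDl.
rewrite summxE sumr_ge0 // => k _.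
have /(_ i j) := powmx_ge0 k A0.
by rewrite !mxE => ?; rewrite mulr_ge0 ?invr_ge0.
Unshelve. all: by end_near. Qed.

Lemma expmx_ge0 : lemx 0 (expmx A).
Proof. by apply: lemx_trans (expsum_le_expmx 0); rewrite /expsum big_nil. Qed.

Lemma pow_le_expmx k : lemx (A ^+ k) (k`!%:R *: expmx A).
Proof.
move=> i j; have /(_ i j) := expsum_le_expmx k.+1.
rewrite /expsum big_nat_recr //= [leLHS]mxE -/(expsum A k) [(_ *: expmx A) i j]mxE.
move=> h; rewrite -ler_pdivrMl ?ltr0n ?fact_gt0 //; apply: le_trans h.
by have := expsum_ge0 k i j; rewrite !mxE => h; rewrite lerDr.
Qed.

Lemma one_add_le_expmx : lemx (1 + A) (expmx A).
Proof.
apply: lemx_trans (expsum_le_expmx 2).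
by rewrite /expsum 2?big_ltn // big_geq // addr0 expr0 expr1 !invr1 !scale1r.
Qed.

(* Termwise, 1/k! <= 1/(k-1)!. *)
Lemma expmx_le_one_add : lemx (expmx A) (1 + A * expmx A).
Proof.
apply: (@mxcvg_le _ _ (expsum A) (fun N => 1 + A * expsum A N)).
- exact: cvg_expmx.
- move=> i j; rewrite mxE; under eq_fun do rewrite mxE.
  apply: cvgD; first exact: cvg_cst.
  by apply: mxcvgM; [exact: mxcvg_cst | exact: cvg_expmx].
case=> [|N].
  rewrite /expsum !big_nil mulr0 addr0; exact: onemx_ge0.
rewrite {1}/expsum big_nat_recl // expr0 invr1 scale1r.
apply: lemxD => //; rewrite /expsum big_nat_recr //= mulrDr mulr_sumr.
rewrite -[X in lemx X _]addr0; apply: lemxD.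
  move=> i j; rewrite !summxE ler_sum // => k _.
  rewrite mulmxZr -exprS !mxE.
  have /(_ i j) := powmx_ge0 k.+1 A0; rewrite mxE => ?.
  rewrite ler_wpM2r // lef_pV2 ?posrE ?ltr0n ?fact_gt0 // ler_nat.
  by rewrite factS leq_pmull.
apply: mulmx_ge0 => //; apply: scalemx_ge0; first by rewrite invr_ge0.
exact: powmx_ge0.
Qed.

(* A expmx A = sum_k k A^k / k!: below M the weight k is at most M, and
   above M the terms are dominated by G / (k-1)!. *)
Lemma mul_expmx_le (G : 'M[R]_n) (M : nat) : lemx 0 G ->
  (forall k, (M < k)%N -> lemx (A ^+ k) G) ->
  lemx (A * expmx A) (M%:R *: expmx A + (expR 1 / M`!%:R) *: G).
Proof.
move=> G0 AG.
apply: (@mxcvg_le _ _ (fun N => A * expsum A N)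
  (fun=> M%:R *: expmx A + (expR 1 / M`!%:R) *: G)).
- by apply: mxcvgM; [exact: mxcvg_cst | exact: cvg_expmx].
- exact: mxcvg_cst.
move=> N i j.
have Ak0 k : 0 <= (A ^+ k) i j.
  by have /(_ i j) := powmx_ge0 k A0; rewrite mxE.
have G0' : 0 <= G i j by have := G0 i j; rewrite mxE.
have -> : (A * expsum A N) i j = \sum_(0 <= k < N) k`!%:R^-1 * (A ^+ k.+1) i j.
  rewrite /expsum mulr_sumr summxE; apply: eq_bigr => k _.
  by rewrite mulmxZr -exprS mxE.
(* Term [k] is [k + 1] times [A^(k+1) / (k+1)!]. For [k < M] the weight is at most [M]; for
   [k >= M], [k! >= M! (k - M)!], and the sum of the [1 / (k - M)!] produces [e / M!]. *)
have le_term k : k`!%:R^-1 * (A ^+ k.+1) i j <=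
    (if (k < M)%N then M%:R * (k.+1`!%:R^-1 * (A ^+ k.+1) i j) else 0) +
    (if (M <= k)%N then M`!%:R^-1 * ((k - M)`!%:R^-1 * G i j) else 0).
  case: ltnP => kM.
    rewrite addr0 factS natrM invfM !mulrA ler_wpM2r //.
    rewrite ler_peMl ?invr_ge0 // ler_pdivlMr ?ltr0n// mul1r ler_nat //.
  rewrite add0r mulrA ler_pM ?invr_ge0 //; last exact: AG.
  rewrite -invfM -natrM lef_pV2 ?posrE ?ltr0n ?muln_gt0 ?fact_gt0 // ler_nat.
  by rewrite -[leqRHS](bin_fact kM) leq_pmull // bin_gt0.
apply: le_trans (ler_sum _ (fun k _ => le_term k)) _.
rewrite big_split /= [leRHS]mxE; apply: lerD.
  rewrite [leRHS]mxE -big_mkcond /= -mulr_sumr ler_wpM2l //.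
  apply: le_trans (expsum_le_expmx N.+1 i j).
  rewrite expsumE /series /= big_nat_recl // -[leLHS]add0r lerD ?expr0//.
    by rewrite divr_ge0//; exact: Ak0 0.
  rewrite [leLHS]big_mkcond /= ler_sum // => k _.
  by rewrite mulrC; case: ifP => // _; rewrite divr_ge0.
rewrite [leRHS]mxE -big_mkcond /= -mulr_sumr -mulr_suml.
rewrite [_ / _]mulrC -mulrA ler_wpM2l ?invr_ge0// ler_wpM2r //.
have [MN|NM] := leqP M N; last first.
  rewrite big1_seq ?expR_ge0 // => k /andP[Mk]; rewrite mem_index_iota /=.
  by move=> kN; have := leq_ltn_trans (leq_trans (ltnW NM) Mk) kN; rewrite ltnn.
rewrite (big_cat_nat (leq0n _) MN) //= big1_seq ?add0r; last first.
  by move=> k /andP[Mk]; rewrite mem_index_iota /= ltnNge Mk.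
rewrite -{1}[M]add0n big_addn.
rewrite (eq_big xpredT (fun k => exp_coeff (1 : R) k)); first last.
- by move=> k _; rewrite addnK /exp_coeff /= expr1n mul1r.
- by move=> k; rewrite leq_addl.
apply: nondecreasing_cvgn_le (is_cvg_series_exp_coeff 1) _.
apply: nondecreasing_series => k _ _.
by rewrite /exp_coeff /= divr_ge0 ?exprn_ge0.
Qed.

End Nonneg.
End ExpMatrixTheory.

(** * Translations of the torus *)

Lemma expR1_le4 (R : realType) : expR 1 <= 4 :> R.
Proof.
have : 2^-1 <= expR (- 2^-1) :> R by have := expR_ge1Dx (- 2^-1 : R); lra.
rewrite expRN lef_pV2 ?posrE ?expR_gt0 // => h.
have -> : 1 = 2^-1 + 2^-1 :> R by lra.
rewrite expRD; have := expR_ge0 (2^-1 : R); nra.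
Qed.

Lemma exp2_fact_le m : (2 ^ m * m`! <= (m.*2)`!)%N.
Proof.
elim: m => // m IH; rewrite doubleS !factS expnS.
rewrite mulnACA mul2n -doubleS (leq_trans (leq_mul (leqnn _) IH)) //.
by rewrite doubleS leq_mul2l /= leq_pmull.
Qed.

Section Torus.
Context {R : realType} (d m : nat).
Notation S := (state d m).
Notation M := ('M[R]_#|{: S}|).

(** The translations as permutation matrices, a representation of the group: multiplication on the
    left reads row [i + v]. *)
Definition shiftmx (v : S) : M :=
  \matrix_(i, j) (enum_val i + v == enum_val j)%:R.

Lemma shiftmx_mul v (B : M) i j :
  (shiftmx v * B) i j = B (enum_rank (enum_val i + v)) j.
Proof.
rewrite mxE (bigD1 (enum_rank (enum_val i + v))) //= mxE enum_rankK eqxx mul1r.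
rewrite big1 ?addr0 // => k /negP ki; rewrite mxE; case: eqP => [e|]; last by rewrite mul0r.
by case: ki; rewrite e enum_valK.
Qed.

Lemma shiftmxD u v : shiftmx u * shiftmx v = shiftmx (u + v).
Proof. by apply/matrixP => i j; rewrite shiftmx_mul !mxE enum_rankK addrA. Qed.

Lemma shiftmx0 : shiftmx 0 = 1.
Proof. by apply/matrixP => i j; rewrite !mxE addr0 (inj_eq enum_val_inj). Qed.

Lemma shiftmxX v k : shiftmx v ^+ k = shiftmx (v *+ k).
Proof.
elim: k => [|k IH]; first by rewrite expr0 mulr0n shiftmx0.
by rewrite exprS IH shiftmxD mulrS.
Qed.

Lemma shiftmx_comm u v : GRing.comm (shiftmx u) (shiftmx v).
Proof. by rewrite /GRing.comm !shiftmxD addrC. Qed.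

Lemma shiftmx_ge0 v : lemx 0 (shiftmx v).
Proof. by move=> i j; rewrite !mxE ler0n. Qed.

Definition displacement (w : walk) (s : jump w d m) : S := move s 0.

Lemma moveE (w : walk) (s : jump w d m) x : move s x = x + displacement s.
Proof.
case: w s => s; rewrite /displacement /= ?add0r //.
by case: s.2; rewrite ?add0r.
Qed.

Definition jumpmx (w : walk) (r : jump w d m -> R) : M :=
  \sum_s r s *: shiftmx (displacement s).

Lemma jumpmx_mul (w : walk) (r : jump w d m -> R) (B : M) x j :
  (jumpmx r * B) (enum_rank x) j = \sum_s r s * B (enum_rank (move s x)) j.
Proof.
rewrite /jumpmx mulr_suml summxE; apply: eq_bigr => s _.
by rewrite mulmxZl mxE shiftmx_mul enum_rankK moveE.
Qed.

Lemma jumpmxE (w : walk) (r : jump w d m -> R) x y :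
  jumpmx r (enum_rank x) (enum_rank y) = \sum_s r s * (move s x == y)%:R.
Proof.
rewrite -[jumpmx r]mulr1 jumpmx_mul; apply: eq_bigr => s _.
by rewrite mxE (inj_eq enum_rank_inj).
Qed.

Lemma jumpmx_ge0 (w : walk) (r : jump w d m -> R) :
  (forall s, 0 <= r s) -> lemx 0 (jumpmx r).
Proof.
by move=> r0; apply: summx_ge0 => s _; apply: scalemx_ge0 => //; exact: shiftmx_ge0.
Qed.

Lemma generatorE (w : walk) (r : jump w d m -> R) :
  generator r = jumpmx r - (\sum_s r s)%:M.
Proof.
apply/matrixP => i j; rewrite -[i]enum_valK -[j]enum_valK [RHS]mxE jumpmxE !mxE.
rewrite -sumrMnl -sumrB; apply: eq_bigr => s _.
by rewrite !enum_rankK mulrBr mulr_natr mulr_natr.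
Qed.

(** The holding part of the generator is scalar, so it commutes and splits off; for nonnegative
    rates the exponential of a nonnegative matrix remains. *)
Lemma expmx_generator (w : walk) (r : jump w d m -> R) (t : R) :
  expmx (t *: generator r) =
  expR (- (t * \sum_s r s)) *: expmx (t *: jumpmx r).
Proof.
rewrite generatorE scalerBr scale_scalar_mx -raddfN /= addrC expmxD.
  by rewrite expmx_scalar -[LHS]/(_ *m _) mul_scalar_mx.
rewrite /GRing.comm -[LHS]/(_ *m _) -[RHS]/(_ *m _).
by rewrite mul_scalar_mx mul_mx_scalar.
Qed.

Definition coord (w : walk) : jump w d m -> 'I_d :=
  match w return jump w d m -> 'I_d with NNRW => fst | URW => fst end.

Definition coordmx (w : walk) (l : 'I_d) : M :=
  \sum_(s : jump w d m | coord s == l) rate R w m *: shiftmx (displacement s).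

Lemma jumpmx_coord (w : walk) :
  jumpmx (fun _ : jump w d m => rate R w m) = \sum_l coordmx w l.
Proof. by rewrite /jumpmx (partition_big (@coord w) xpredT). Qed.

Lemma rate_ge0 (w : walk) : 0 <= rate R w m.
Proof. by case: w; rewrite /= invr_ge0. Qed.

Lemma coordmx_ge0 (w : walk) l : lemx 0 (coordmx w l).
Proof.
by apply: summx_ge0 => s _; apply: scalemx_ge0 (rate_ge0 w) _; exact: shiftmx_ge0.
Qed.

Lemma coordmx_comm (w : walk) l l' : GRing.comm (coordmx w l) (coordmx w l').
Proof.
apply: commr_sum => s _; apply: commr_sym; apply: commr_sum => s' _.
by rewrite /GRing.comm !mulmxZl !mulmxZr shiftmx_comm !scalerA mulrC.
Qed.

(** For [m >= 2] this is [m] times the averaging along the [l]-axis; it absorbs every translation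
    along that axis. *)
Definition linemx (l : 'I_d) : M :=
  \sum_(k : 'Z_m) shiftmx (k *: delta_mx 0 l).

Lemma linemx_ge0 l : lemx 0 (linemx l).
Proof. by apply: summx_ge0 => s _; exact: shiftmx_ge0. Qed.

Lemma shift_linemx l (k : 'Z_m) : shiftmx (k *: delta_mx 0 l) * linemx l = linemx l.
Proof.
rewrite /linemx mulr_sumr [RHS](reindex_inj (addrI k)) /=.
by apply: eq_bigr => k' _; rewrite shiftmxD -scalerDl.
Qed.

Lemma one_le_linemx l : lemx 1 (linemx l).
Proof.
rewrite /linemx (bigD1 0) //= scale0r shiftmx0 -[X in lemx X _]addr0.
by apply: lemxD => //; apply: summx_ge0 => s _; exact: shiftmx_ge0.
Qed.

Hypothesis m2 : (2 <= m)%N.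

Lemma linemxM l : linemx l * linemx l = m%:R *: linemx l.
Proof.
rewrite {1}/linemx mulr_suml (eq_bigr (fun=> linemx l)) => [|k _]; last exact: shift_linemx.
by rewrite sumr_const scaler_nat; congr (_ *+ _); rewrite card_ord Zp_cast.
Qed.

Lemma coordmx_URW l : coordmx URW l = m%:R^-1 *: (linemx l - 1).
Proof.
rewrite /coordmx /linemx (bigD1 0) //= scale0r shiftmx0 [1 + _]addrC addrK.
rewrite scaler_sumr (eq_bigl (fun s : jump URW d m => (s.1 == l) && true)); last first.
  by move=> s; rewrite andbT.
rewrite -(pair_big_dep (pred1 l) (fun _ _ => true)
  (fun (a : 'I_d) (b : {n : 'Z_m | n != 0}) =>
     m%:R^-1 *: shiftmx (displacement ((a, b) : jump URW d m)))) /= big_pred1_eq.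
rewrite (big_sub (fun n : 'Z_m => n != 0) (fun n => m%:R^-1 *: shiftmx (n *: delta_mx 0 l))).
by apply: eq_bigr => n _; rewrite /displacement /= add0r.
Qed.

Lemma coordmx_NNRW l : coordmx NNRW l =
  2^-1 *: (shiftmx (delta_mx 0 l) + shiftmx (- delta_mx 0 l)).
Proof.
rewrite /coordmx.
rewrite (eq_bigl (fun s : jump NNRW d m => (s.1 == l) && true)); last first.
  by move=> s; rewrite andbT.
rewrite -(pair_big_dep (pred1 l) (fun _ _ => true)
  (fun (a : 'I_d) (b : bool) =>
     2^-1 *: shiftmx (displacement ((a, b) : jump NNRW d m)))) /= big_pred1_eq.
by rewrite big_bool /displacement /= add0r sub0r scalerDr.
Qed.

End Torus.

(** * Mean number of jumps given both endpoints *)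

Section KeyBound.
Context {R : realType} (d m : nat).
Hypothesis m2 : (2 <= m)%N.
Notation S := (state d m).
Notation M := ('M[R]_#|{: S}|).

Lemma scalemxX (s : R) (B : M) k : (s *: B) ^+ k = s ^+ k *: B ^+ k.
Proof.
elim: k => [|k IH]; first by rewrite !expr0 scale1r.
by rewrite !exprS IH mulmxZl mulmxZr scalerA.
Qed.

Lemma powmx_le (B B' : M) k : lemx 0 B -> lemx B B' -> lemx (B ^+ k) (B' ^+ k).
Proof.
move=> B0 BB'; elim: k => [|k IH]; first by rewrite !expr0.
by rewrite !exprS; apply: lemxM => //; exact: powmx_ge0.
Qed.

Lemma lemxZr (a b : R) (B : M) : a <= b -> lemx 0 B -> lemx (a *: B) (b *: B).
Proof. by move=> ab B0 i j; have := B0 i j; rewrite !mxE => ?; rewrite ler_wpM2r. Qed.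

(* J / m is idempotent, for J the sum of all the translations along the l-axis. *)
Lemma coordmx_URW_exp (l : 'I_d) (s : R) : 0 <= s <= 1 ->
  lemx (s *: coordmx m URW l * expmx (s *: coordmx m URW l))
       (4 *: expmx (s *: coordmx m URW l)).
Proof.
move=> /andP[s0 s1].
have m0 : 0 < m%:R :> R by rewrite ltr0n; exact: leq_trans m2.
set B : M := s *: coordmx m URW l.
have B0 : lemx 0 B by apply: scalemx_ge0 => //; exact: coordmx_ge0.
pose P : M := m%:R^-1 *: linemx m l.
have P0 : lemx 0 P by apply: scalemx_ge0; [rewrite invr_ge0 ltW | exact: linemx_ge0].
have PP : P * P = P.
  by rewrite /P mulmxZl mulmxZr linemxM // !scalerA -mulrA mulVf ?gt_eqF // mulr1.
have BE : s *: P = B + (s / m%:R) *: (1 : M).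
  by rewrite /B coordmx_URW // /P !scalerA scalerBr subrK.
have B_le : lemx B (s *: P).
  rewrite BE -[X in lemx X _]addr0; apply: lemxD => //.
  by apply: scalemx_ge0; [rewrite divr_ge0 // ltW | exact: onemx_ge0].
have sP0 : lemx 0 (s *: P) by exact: scalemx_ge0.
have Bk k : (0 < k)%N -> lemx (B ^+ k) (s *: P).
  case: k => // k _; elim: k => [|k IH]; first by rewrite expr1.
  rewrite exprS; apply: (@lemx_trans _ _ (s *: P * (s *: P))).
    by apply: lemxM => //; exact: powmx_ge0.
  by rewrite mulmxZl mulmxZr PP scalerA; apply: lemxZr => //; nra.
(* Here [M = 0] and [G = s P], so the bound is [e s P]; and [s P = B + s / m <= 1 + B <= e^B] since
   [s <= 1 <= m]. *)
apply: lemx_trans (mul_expmx_le B0 sP0 Bk) _.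
rewrite scale0r add0r fact0 divr1.
apply: (@lemx_trans _ _ (4 *: (s *: P))); first by apply: lemxZr => //; exact: expR1_le4.
apply: lemxZ => //; apply: lemx_trans (one_add_le_expmx B0).
rewrite BE addrC; apply: lemxD => //; rewrite -[X in lemx _ X]scale1r.
apply: lemxZr; last exact: onemx_ge0.
have : 1 <= m%:R :> R by rewrite ler1n; exact: leq_trans m2.
by move=> ?; rewrite ler_pdivrMr //; lra.
Qed.

(* Every point of the line is reached in some k < m jumps, with weight at least
   2^-k / k!; as 2^m m! <= (2m)!, this dominates the paths of more than 2m jumps. *)
Lemma coordmx_NNRW_exp (l : 'I_d) (s : R) : 0 <= s <= 1 ->
  lemx (s *: coordmx m NNRW l * expmx (s *: coordmx m NNRW l))
       ((4 * m%:R) *: expmx (s *: coordmx m NNRW l)).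
Proof.
move=> /andP[s0 s1].
set A : M := coordmx m NNRW l; set B := s *: A; pose J : M := linemx m l.
have A0 : lemx 0 A by exact: coordmx_ge0.
have B0 : lemx 0 B by exact: scalemx_ge0.
have J0 : lemx 0 J by exact: linemx_ge0.
have E0 : lemx 0 (expmx B) by exact: expmx_ge0.
have AJ : A * J = J.
  have h (k : 'Z_m) : shiftmx (k *: delta_mx 0 l) * J = J by exact: shift_linemx.
  rewrite /A coordmx_NNRW mulmxZl mulrDl.
  have := h 1; rewrite scale1r => ->; have := h (-1); rewrite scaleN1r => ->.
  by rewrite -mulr2n -[J *+ 2]scaler_nat scalerA mulVf ?scale1r // pnatr_eq0.
have Ak k : lemx (A ^+ k) J.
  elim: k => [|k IH]; first by rewrite expr0; exact: one_le_linemx.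
  by rewrite exprS -AJ; apply: lemxM => //; exact: powmx_ge0.
(* The factor [s^m] must be kept: a point at [k] jumps has weight of order [s^k] in [e^B], so [J]
   alone is not dominated uniformly as [s] tends to 0. *)
have Bk k : (m.*2 < k)%N -> lemx (B ^+ k) (s ^+ m *: J).
  move=> mk; rewrite scalemxX.
  apply: lemx_trans (lemxZ (exprn_ge0 k s0) (Ak k)) _.
  apply: lemxZr => //; apply: ler_wiXn2l => //.
  by rewrite ltnW // (leq_ltn_trans _ mk) // -addnn leq_addr.
(* For [k < m], [2^k k! <= 2^m (m-1)!]; the [m] translations together cost [m (m-1)! = m!]. *)
have J_le : lemx (s ^+ m *: J) ((2 ^+ m * m`!%:R) *: expmx B).
  have -> : (2 ^+ m * m`!%:R) *: expmx B =
      \sum_(k : 'Z_m) (2 ^+ m * m.-1`!%:R) *: expmx B.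
    transitivity (((2 ^+ m * m.-1`!%:R) *: expmx B) *+ m); last first.
      by rewrite sumr_const; congr (_ *+ _); rewrite card_ord Zp_cast.
    rewrite -scaler_nat scalerA; congr (_ *: _).
    by rewrite -{2}(prednK (ltnW m2)) factS natrM (prednK (ltnW m2)); ring.
  rewrite /J scaler_sumr; apply: lemx_sum => k _.
  have km : (k < m)%N by rewrite -[X in (_ < X)%N](Zp_cast m2).
  have -> : shiftmx (k *: delta_mx 0 l) = shiftmx (delta_mx 0 l) ^+ k :> M.
    by rewrite shiftmxX -scaler_nat natr_Zp.
  apply: (@lemx_trans _ _ (s ^+ k *: (2 *: A) ^+ k)).
    apply: (@lemx_trans _ _ (s ^+ k *: (shiftmx (delta_mx 0 l)) ^+ k)).
      apply: lemxZr; last by apply: powmx_ge0; exact: shiftmx_ge0.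
      by apply: ler_wiXn2l => //; exact: ltnW.
    apply: lemxZ; first exact: exprn_ge0.
    apply: powmx_le; first exact: shiftmx_ge0.
    rewrite /A coordmx_NNRW scalerA mulfV ?pnatr_eq0 // scale1r -[X in lemx X _]addr0.
    by apply: lemxD => //; exact: shiftmx_ge0.
  have -> : s ^+ k *: (2 *: A) ^+ k = 2 ^+ k *: B ^+ k.
    by rewrite /B !scalemxX !scalerA mulrC.
  apply: (@lemx_trans _ _ (2 ^+ k *: (k`!%:R *: expmx B))).
    by apply: lemxZ; [exact: exprn_ge0 | exact: pow_le_expmx].
  rewrite scalerA; apply: lemxZr => //; apply: ler_pM => //.
    by rewrite ler_eXn2l ?ltr1n //; exact: ltnW.
  by rewrite ler_nat leq_fact // -ltnS prednK // ltnW.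
apply: lemx_trans (mul_expmx_le B0 (scalemx_ge0 (exprn_ge0 m s0) J0) Bk) _.
(* The tail costs [e 2^m m! / (2m)! <= e <= 4], and [2m + 4 <= 4m]. *)
apply: (@lemx_trans _ _ (m.*2%:R *: expmx B + 4 *: expmx B)).
  apply: lemxD => //.
  apply: lemx_trans (lemxZ _ J_le) _; first by rewrite divr_ge0 ?expR_ge0.
  rewrite scalerA; apply: lemxZr => //.
  have f0 : 0 < m.*2`!%:R :> R by rewrite ltr0n fact_gt0.
  have : 2 ^+ m * m`!%:R <= m.*2`!%:R :> R by rewrite -natrX -natrM ler_nat exp2_fact_le.
  move=> h; rewrite mulrAC ler_pdivrMr //; have := expR1_le4 R.
  have := expR_ge0 (1 : R); have : 0 <= 2 ^+ m * m`!%:R :> R by rewrite mulr_ge0 ?exprn_ge0.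
  by move=> *; rewrite ler_pM.
rewrite -scalerDl; apply: lemxZr => //.
have : 2 <= m%:R :> R by rewrite ler_nat.
by rewrite -mul2n natrM; lra.
Qed.

Lemma coordmx_exp w (l : 'I_d) (s : R) : 0 <= s <= 1 ->
  lemx (s *: coordmx m w l * expmx (s *: coordmx m w l))
       ((4 * Cwalk R w m) *: expmx (s *: coordmx m w l)).
Proof.
case: w => s01; first exact: coordmx_NNRW_exp.
by rewrite /= mulr1; exact: coordmx_URW_exp.
Qed.

(* The ratio of the two sides is the expected number of jumps in time s given
   the endpoints. *)
Lemma jumpmx_exp w (s : R) : 0 <= s <= 1 ->
  let A : M := jumpmx (fun _ : jump w d m => rate R w m) in
  lemx (s *: A * expmx (s *: A)) ((4 * Cwalk R w m * d%:R) *: expmx (s *: A)).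
Proof.
move=> s01 A; have /andP[s0 s1] := s01.
have -> : s *: A * expmx (s *: A) = \sum_l s *: coordmx m w l * expmx (s *: A).
  by rewrite {1}/A jumpmx_coord scaler_sumr mulr_suml.
have -> : (4 * Cwalk R w m * d%:R) *: expmx (s *: A) =
    \sum_(l < d) (4 * Cwalk R w m) *: expmx (s *: A).
  by rewrite sumr_const card_ord -[RHS]scaler_nat scalerA [d%:R * _]mulrC.
apply: lemx_sum => l _.
(* The other coordinates commute with the [l]-th one, so their exponential is a nonnegative factor
   common to both sides of the one-coordinate bound. *)
pose A' : M := \sum_(l' | l' != l) coordmx m w l'.
have AE : s *: A = s *: coordmx m w l + s *: A'.
  by rewrite -scalerDr /A jumpmx_coord (bigD1 l).
have c : GRing.comm (s *: coordmx m w l) (s *: A').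
  rewrite /GRing.comm !mulmxZl !mulmxZr; congr (_ *: (_ *: _)).
  by apply: commr_sum => l' _; exact: coordmx_comm.
rewrite AE expmxD // mulrA -mulmxZl; apply: lemxM.
- apply: mulmx_ge0; [|apply: expmx_ge0]; by apply: scalemx_ge0 => //; exact: coordmx_ge0.
- exact: coordmx_exp.
- apply: expmx_ge0; apply: scalemx_ge0 => //; apply: summx_ge0 => l' _; exact: coordmx_ge0.
- exact: lemx_refl.
Qed.

End KeyBound.

(** Only the term of order 0 survives. Applied to a generator and a constant matrix, this is
    conservation of mass. *)
Lemma expmx_fix (R : realType) n (B U : 'M[R]_n) : B * U = 0 -> expmx B * U = U.
Proof.
move=> BU; apply: (@mxcvg_unique _ _ (fun N => expsum B N * U)).
  by apply: mxcvgM; [exact: cvg_expmx | exact: mxcvg_cst].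
move=> i j; apply: cvg_near_cst; exists 1%N => // -[|N] //= _.
rewrite /expsum big_nat_recl // expr0 invr1 scale1r mulrDl mul1r mulr_suml.
rewrite big1 ?addr0 // => k _.
by rewrite mulmxZl exprSr -mulrA BU mulr0 scaler0.
Qed.

Lemma expmx0 (R : realType) n : expmx (0 : 'M[R]_n) = 1.
Proof. by rewrite -[RHS](expmx_fix (mul0r 1)) mulr1. Qed.

(** * Transition probabilities *)

Section Transition.
Context {R : realType} (d m : nat).
Notation S := (state d m).
Notation M := ('M[R]_#|{: S}|).

Lemma mulmx_rank (B C : M) (x y : S) :
  (B * C) (enum_rank x) (enum_rank y) =
  \sum_z B (enum_rank x) (enum_rank z) * C (enum_rank z) (enum_rank y).
Proof.
by rewrite mxE [LHS](reindex (@enum_rank S)) //=; apply/onW_bij/enum_rank_bij.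
Qed.

Section Rates.
Variables (w : walk) (r : jump w d m -> R).
Hypothesis r0 : forall s, 0 <= r s.

Lemma transition_sum1 t x : \sum_y transition r t x y = 1.
Proof.
pose U : M := const_mx 1.
have GU : (t *: generator r) * U = 0.
  rewrite mulmxZl generatorE mulrBl -[_%:M * _]/(_ *m _) mul_scalar_mx.
  have -> : jumpmx r * U = (\sum_s r s) *: U.
    rewrite /jumpmx mulr_suml scaler_suml; apply: eq_bigr => s _.
    rewrite mulmxZl; congr (_ *: _); apply/matrixP => i j.
    by rewrite shiftmx_mul !mxE.
  by rewrite subrr scaler0.
have /matrixP/(_ (enum_rank x) (enum_rank x)) := expmx_fix GU.
rewrite mulmx_rank [RHS]mxE => <-; apply: eq_bigr => y _.
by rewrite [U _ _]mxE mulr1.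
Qed.

Lemma transitionE t x y : transition r t x y =
  expR (- (t * \sum_s r s)) * expmx (t *: jumpmx r) (enum_rank x) (enum_rank y).
Proof. by rewrite /transition expmx_generator mxE. Qed.

Lemma tjumpmx_ge0 t : 0 <= t -> lemx 0 (t *: jumpmx r).
Proof. by move=> t0; apply: scalemx_ge0 => //; exact: jumpmx_ge0. Qed.

Lemma transition_ge0 t x y : 0 <= t -> 0 <= transition r t x y.
Proof.
move=> t0; rewrite transitionE mulr_ge0 ?expR_ge0 //.
by have /(_ (enum_rank x) (enum_rank y)) := expmx_ge0 (tjumpmx_ge0 t0); rewrite mxE.
Qed.

(** Only the terms with no jump and with one jump are kept. *)
Lemma transition_lower t x y : 0 <= t ->
  expR (- (t * \sum_s r s)) * ((x == y)%:R + t * \sum_s r s * (move s x == y)%:R)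
  <= transition r t x y.
Proof.
move=> t0; rewrite transitionE ler_wpM2l ?expR_ge0 //.
have /(_ (enum_rank x) (enum_rank y)) := one_add_le_expmx (tjumpmx_ge0 t0).
by rewrite [leLHS]mxE [X in X + _]mxE [X in _ + X]mxE jumpmxE (inj_eq enum_rank_inj).
Qed.

(** Markov's inequality for the number of jumps: arriving at [y] after at least one jump is at most
    as likely as the mean number of jumps on the event of arriving at [y], which is the last
    term. *)
Lemma transition_upper t x y : 0 <= t ->
  transition r t x y <=
  expR (- (t * \sum_s r s)) * (x == y)%:R
  + t * \sum_s r s * transition r t (move s x) y.
Proof.
move=> t0.
have /(_ (enum_rank x) (enum_rank y)) := expmx_le_one_add (tjumpmx_ge0 t0).
rewrite [leRHS]mxE [X in X + _]mxE mulmxZl [X in _ + X]mxE jumpmx_mul (inj_eq enum_rank_inj).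
move=> /(ler_wpM2l (expR_ge0 (- (t * \sum_s r s)))); rewrite -transitionE.
move=> /le_trans; apply; rewrite mulrDr lerD2l mulrCA ler_wpM2l // mulr_sumr.
by rewrite ler_sum // => s _; rewrite transitionE mulrCA.
Qed.

Lemma transition_semigroup s t x y :
  \sum_z transition r s x z * transition r t z y = transition r (s + t) x y.
Proof.
rewrite /transition scalerDl expmxD ?mulmx_rank //.
by rewrite /GRing.comm !mulmxZl !mulmxZr !scalerA mulrC.
Qed.

Lemma transition0 x y : transition r 0 x y = (x == y)%:R.
Proof. by rewrite /transition scale0r expmx0 mxE (inj_eq enum_rank_inj). Qed.

(** The generator is the jump matrix minus a scalar, so the jump matrix commutes with the semigroup,
    and a jump made at the end may be moved to the start. *)
Lemma transition_jump t (f : S -> R) x :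
  \sum_z transition r t x z * (\sum_a r a * f (move a z)) =
  \sum_a r a * \sum_z transition r t (move a x) z * f z.
Proof.
(* All columns of [C] are equal to [f], so the column index read below is arbitrary. *)
pose C : M := \matrix_(i, j) f (enum_val i).
have c : expmx (t *: generator r) * jumpmx r = jumpmx r * expmx (t *: generator r).
  apply: expmx_comm; rewrite /GRing.comm mulmxZl mulmxZr generatorE mulrBl mulrBr.
  by rewrite -[_%:M * _]/(_ *m _) -[_ * _%:M]/(_ *m _) scalar_mxC.
have /(congr1 (fun B : M => (B * C) (enum_rank x) (enum_rank x))) := c.
rewrite -!mulrA mulmx_rank jumpmx_mul => e.
transitivity (\sum_z transition r t x z * (jumpmx r * C) (enum_rank z) (enum_rank x)).
  apply: eq_bigr => z _; congr (_ * _); rewrite jumpmx_mul; apply: eq_bigr => a _.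
  by rewrite mxE enum_rankK.
rewrite {}e; apply: eq_bigr => a _; congr (_ * _); rewrite mulmx_rank.
by apply: eq_bigr => z _; rewrite [C _ _]mxE enum_rankK.
Qed.

End Rates.

End Transition.

Section BaseProcess.
Context {R : realType} (d m : nat) (w : walk).
Hypothesis m2 : (2 <= m)%N.
Notation S := (state d m).
Notation p := (@ptrans R w d m).
Notation lam := (rate R w m).

(** [t * jtrans t x y] is the mean number of jumps in time [t] on the event of going from [x] to
    [y]; [t ^+ 2 * jtrans2 t x y] is the mean number of ordered pairs of distinct jumps on that
    event. *)
Definition jtrans (t : R) (x y : S) : R :=
  \sum_(a : jump w d m) lam * p t (move a x) y.
Definition jtrans2 (t : R) (x y : S) : R :=
  \sum_(a : jump w d m) lam * jtrans t (move a x) y.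
Definition jbound : R := 4 * Cwalk R w m * d%:R.

Lemma jbound_ge0 : 0 <= jbound.
Proof. by rewrite /jbound; case: w => /=; rewrite ?mulr1 ?mulr_ge0. Qed.

Lemma ptrans_ge0 t x y : 0 <= t -> 0 <= p t x y.
Proof. by apply: transition_ge0 => s; exact: rate_ge0. Qed.

Lemma jtrans_ge0 t x y : 0 <= t -> 0 <= jtrans t x y.
Proof. by move=> t0; apply: sumr_ge0 => a _; rewrite mulr_ge0 ?rate_ge0 ?ptrans_ge0. Qed.

Lemma ptrans_semigroup s t x y : \sum_z p s x z * p t z y = p (s + t) x y.
Proof. exact: transition_semigroup. Qed.

Lemma ptrans_jtrans s t x y : \sum_z p s x z * jtrans t z y = jtrans (s + t) x y.
Proof.
rewrite [LHS](transition_jump _ s (p t ^~ y)); apply: eq_bigr => a _.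
by congr (_ * _); exact: ptrans_semigroup.
Qed.

Lemma ptrans_jtrans2 s t x y : \sum_z p s x z * jtrans2 t z y = jtrans2 (s + t) x y.
Proof.
rewrite [LHS](transition_jump _ s (jtrans t ^~ y)); apply: eq_bigr => a _.
by congr (_ * _); exact: ptrans_jtrans.
Qed.

Lemma jtrans_le s x y : 0 <= s <= 1 -> s * jtrans s x y <= jbound * p s x y.
Proof.
move=> s01; have /(_ (enum_rank x) (enum_rank y)) := @jumpmx_exp R d m m2 w s s01.
rewrite mulmxZl [leLHS]mxE jumpmx_mul [leRHS]mxE -/jbound.
move=> /(ler_wpM2l (expR_ge0 (- (s * \sum_(a : jump w d m) lam)))) h.
rewrite /ptrans /jtrans transitionE [leRHS]mulrCA.
apply: le_trans h; rewrite [leRHS]mulrCA ler_wpM2l //; first by case/andP: s01.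
by rewrite mulr_sumr ler_sum // => a _; rewrite /ptrans transitionE [leRHS]mulrCA.
Qed.

Lemma jtrans1_le x y : jtrans 1 x y <= jbound * p 1 x y.
Proof. by have := @jtrans_le 1 x y; rewrite mul1r; apply; rewrite ler01 lexx. Qed.

Lemma jtrans21_le x y : jtrans2 1 x y <= jbound ^+ 2 * p 1 x y.
Proof.
apply: (@le_trans _ _ (jbound * jtrans 1 x y)).
  rewrite /jtrans2 {2}/jtrans mulr_sumr ler_sum // => a _.
  by rewrite mulrCA ler_wpM2l ?rate_ge0 // jtrans1_le.
by rewrite expr2 -mulrA ler_wpM2l ?jbound_ge0 ?jtrans1_le.
Qed.

End BaseProcess.

(* Since the total mass vanishes, a one-sided bound controls both signs. *)
Lemma sum_norm_le (R : realType) (T : finType) (D N : T -> R) :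
  \sum_x D x = 0 -> (forall x, 0 <= N x) -> (forall x, - N x <= D x) ->
  \sum_x `|D x| <= 2 * \sum_x N x.
Proof.
move=> D0 N0 ND; have -> : 2 * \sum_x N x = \sum_x (D x + 2 * N x).
  by rewrite big_split /= D0 add0r mulr_sumr.
apply: ler_sum => x _; have := N0 x; have := ND x; rewrite ler_norml.
by move=> *; apply/andP; split; lra.
Qed.

Lemma sum_move (R : realType) (T I : finType) (r : I -> R) (mv : I -> T) (f : T -> R) :
  \sum_x (\sum_a r a * (mv a == x)%:R) * f x = \sum_a r a * f (mv a).
Proof.
under eq_bigr do rewrite mulr_suml.
rewrite exchange_big; apply: eq_bigr => a _ /=.
rewrite (bigD1 (mv a)) //= eqxx mulr1 big1 ?addr0 // => x /negPf xa.
by rewrite eq_sym xa mulr0 mul0r.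
Qed.

Lemma sum_delta (R : realType) (T : finType) (z : T) (f : T -> R) :
  \sum_x (z == x)%:R * f x = f z.
Proof.
rewrite (bigD1 z) //= eqxx mul1r big1 ?addr0 // => x /negPf xz.
by rewrite eq_sym xz mul0r.
Qed.

(** * Comparison on one grid interval *)

Section FirstOrder.
Context {R : realType} (d m : nat) (w : walk).
Notation S := (state d m).

(** A signed kernel of row mass 1: the holding weight is negative when [del] times the total rate
    exceeds 1, which is allowed since only L^1 distances are taken. *)
Definition euler (r : jump w d m -> R) (del : R) (z x : S) : R :=
  (z == x)%:R * (1 - del * \sum_a r a) + del * \sum_a r a * (move a z == x)%:R.

(** Inserting [e^(-a) >= 1 - a] into [transition_lower] leaves as deficit [a] times the jump part of
    [euler], of total mass [a^2]. *)
Lemma transition_euler (r : jump w d m -> R) (del : R) z : (forall a, 0 <= r a) -> 0 <= del ->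
  \sum_x `|transition r del z x - euler r del z x| <= 2 * (del * \sum_a r a) ^+ 2.
Proof.
move=> r0 del0; set a : R := del * \sum_a r a.
have a0 : 0 <= a by rewrite mulr_ge0 // sumr_ge0.
have sumB : \sum_x del * \sum_b r b * (move b z == x)%:R = a.
  rewrite -mulr_sumr /a; congr (_ * _).
  have := sum_move r (fun b => move b z) (fun=> 1).
  by under eq_bigr do rewrite mulr1; under [in RHS]eq_bigr do rewrite mulr1.
have -> : a ^+ 2 = \sum_x a * (del * \sum_b r b * (move b z == x)%:R).
  by rewrite -mulr_sumr sumB expr2.
apply: sum_norm_le => [|x|x].
- rewrite sumrB transition_sum1 big_split /= sumB sum_delta -/a; lra.
- by rewrite !mulr_ge0 // sumr_ge0 // => b _; rewrite mulr_ge0.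
have := transition_lower r0 z x del0; rewrite /euler -/a.
set B : R := del * _; set p : R := transition _ _ _ _.
have B0 : 0 <= B by rewrite mulr_ge0 // sumr_ge0 // => b _; rewrite mulr_ge0.
have := expR_ge1Dx (- a); set e := expR _ => ea h.
have d0 : 0 <= (z == x)%:R :> R by [].
have k : 0 <= (e - (1 - a)) * ((z == x)%:R + B) by rewrite mulr_ge0 ?subr_ge0 // addr_ge0.
by move: h k; move: (_%:R) => c; lra.
Qed.

Lemma euler_lip (r r' : jump w d m -> R) del z : 0 <= del ->
  \sum_x `|euler r del z x - euler r' del z x| <= 2 * (del * \sum_a `|r a - r' a|).
Proof.
move=> del0; pose a := \sum_a `|r a - r' a|.
apply: (@le_trans _ _ (\sum_x ((z == x)%:R * (del * a)
    + del * ((\sum_b `|r b - r' b| * (move b z == x)%:R) * 1)))).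
  apply: ler_sum => x _; rewrite mulr1.
  have -> : euler r del z x - euler r' del z x =
      - ((z == x)%:R * (del * \sum_a (r a - r' a)))
      + del * \sum_a (r a - r' a) * (move a z == x)%:R.
    rewrite /euler sumrB.
    have -> : \sum_a (r a - r' a) * (move a z == x)%:R =
       \sum_a r a * (move a z == x)%:R - \sum_a r' a * (move a z == x)%:R.
      by rewrite -sumrB; apply: eq_bigr => b _; rewrite mulrBl.
    ring.
  apply: le_trans (ler_normD _ _) _; rewrite normrN; apply: lerD.
    rewrite !normrM ger0_norm // (ger0_norm del0) ler_wpM2l // ler_wpM2l //.
    exact: ler_norm_sum.
  rewrite normrM (ger0_norm del0) ler_wpM2l //.
  apply: le_trans (ler_norm_sum _ _ _) _; apply: ler_sum => b _.
  by rewrite normrM [`|_%:R|]ger0_norm.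
rewrite big_split /= sum_delta -mulr_sumr sum_move (eq_bigr _ (fun b _ => mulr1 _)).
by rewrite -/a; lra.
Qed.

End FirstOrder.

(** * Bridges and the interpolant over one step *)

Section Bridge.
Context {R : realType} (d m : nat) (w : walk).
Hypothesis m2 : (2 <= m)%N.
Notation S := (state d m).
Notation p := (@ptrans R w d m).
Notation J1 := (@jtrans R d m w).
Notation J2 := (@jtrans2 R d m w).
Notation D := (@jbound R d m w).
Notation lam := (rate R w m).

Let lam0 (a : jump w d m) : 0 <= (fun=> lam) a. Proof. exact: rate_ge0. Qed.

(** The Euler step of the bridge to [x1], whose rates are the Doob transform [lam * p (del + s)
    (move a z) x1 / p (del + s) z x1], multiplied by [p (del + s) z x1] so that nothing is
    divided. *)
Definition bridge_euler del s (z x x1 : S) : R :=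
  (z == x)%:R * (p (del + s) z x1 - del * J1 (del + s) z x1)
  + del * (\sum_(a : jump w d m) lam * (move a z == x)%:R) * p (del + s) x x1.

(** The lower bound on [p del z x] leaves the factor [e^(-del L) * p s x x1], which by
    [transition_upper] is at least [p (del + s) x x1 - del * J1 (del + s) x x1]. The deficit is a
    jump followed by a marked second jump, whence [J2]. *)
Lemma bridge_step (del s : R) (z x1 : S) : 0 <= del -> 0 <= s ->
  \sum_x `|p del z x * p s x x1 - bridge_euler del s z x x1|
  <= 2 * (del ^+ 2 * J2 (del + s) z x1).
Proof.
move=> del0 s0; have ds0 : 0 <= del + s by exact: addr_ge0.
have -> : del ^+ 2 * J2 (del + s) z x1 = \sum_x
    del * (\sum_(a : jump w d m) lam * (move a z == x)%:R) * (del * J1 (del + s) x x1).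
  rewrite /jtrans2 -(sum_move (fun=> lam) (fun a => move a z) (J1 (del + s) ^~ x1)).
  rewrite mulr_sumr; apply: eq_bigr => x _; ring.
apply: sum_norm_le => [|x|x].
- rewrite sumrB ptrans_semigroup big_split /= sum_delta.
  under eq_bigr do rewrite -mulrA.
  by rewrite -mulr_sumr sum_move; rewrite /jtrans; ring.
- rewrite !mulr_ge0 ?jtrans_ge0 // sumr_ge0 // => a _.
  by rewrite mulr_ge0 // rate_ge0.
have up : p (del + s) x x1 <=
    expR (- (del * \sum_(a : jump w d m) lam)) * p s x x1 + del * J1 (del + s) x x1.
  rewrite -ptrans_semigroup.
  apply: (@le_trans _ _ (\sum_y (expR (- (del * \sum_(a : jump w d m) lam)) * (x == y)%:R
     + del * \sum_(a : jump w d m) lam * p del (move a x) y) * p s y x1)).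
    apply: ler_sum => y _; rewrite ler_wpM2r ?ptrans_ge0 //.
    exact: (transition_upper lam0).
  under eq_bigr do rewrite mulrDl -mulrA -mulrA.
  rewrite big_split /= -mulr_sumr sum_delta lerD2l -mulr_sumr ler_wpM2l //.
  under eq_bigr do rewrite mulr_suml.
  rewrite exchange_big; apply: ler_sum => a _ /=.
  under eq_bigr do rewrite -mulrA.
  by rewrite -mulr_sumr ptrans_semigroup.
have := transition_lower lam0 z x del0; rewrite -/(p _ _ _) /bridge_euler.
move: up; set e := expR _; set B := \sum_(a : jump w d m) _ * _; move=> up low.
have B0 : 0 <= del * B.
  by rewrite mulr_ge0 // sumr_ge0 // => a _; rewrite mulr_ge0 // rate_ge0.
have q0 : 0 <= p s x x1 by exact: ptrans_ge0.
have h1 := ler_wpM2r q0 low; have h2 := ler_wpM2l B0 up.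
have h3 : (z == x)%:R * (p (del + s) z x1 - del * J1 (del + s) z x1) <=
          (z == x)%:R * (e * p s x x1).
  by case: eqP => [->|_]; rewrite ?mul0r // !mul1r; lra.
by move: h1 h2 h3; set c := (z == x)%:R * (_ - _); move: ((z == x)%:R : R) => b *; lra.
Qed.

(** A bridge away from [x1] with time [s] to go still has to jump: this is [transition_upper] over
    the last stretch, averaged over the position, with [e^(-s L) <= p s x1 x1]. *)
Lemma bridge_end (t s : R) (x0 x1 : S) : 0 <= t -> 0 <= s ->
  \sum_z `|p t x0 z * p s z x1 - (x1 == z)%:R * p (t + s) x0 x1|
  <= 2 * (s * J1 (t + s) x0 x1).
Proof.
move=> t0 s0; have ts0 : 0 <= t + s by exact: addr_ge0.
rewrite -[s * _](sum_delta x1 (fun=> s * J1 (t + s) x0 x1)).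
apply: sum_norm_le => [|z|z].
- by rewrite sumrB ptrans_semigroup sum_delta subrr.
- by rewrite !mulr_ge0 ?jtrans_ge0.
case: eqP => [<-|_]; last by rewrite !mul0r subr0 oppr0 mulr_ge0 ?ptrans_ge0.
rewrite !mul1r -ptrans_jtrans -[p (t + s) _ _]ptrans_semigroup.
rewrite lerBrDl -lerBrDr opprK.
have low : expR (- (s * \sum_(a : jump w d m) lam)) <= p s x1 x1.
  have := transition_lower lam0 x1 x1 s0; rewrite -/(p _ _ _) eqxx; apply: le_trans.
  rewrite ler_peMr ?expR_ge0 // lerDl mulr_ge0 // sumr_ge0 // => a _.
  by rewrite mulr_ge0 // rate_ge0.
apply: (@le_trans _ _ (\sum_z p t x0 z *
    (expR (- (s * \sum_(a : jump w d m) lam)) * (z == x1)%:R + s * J1 s z x1))).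
  apply: ler_sum => y _; rewrite ler_wpM2l ?ptrans_ge0 //.
  exact: (transition_upper lam0).
under eq_bigr do rewrite mulrDr.
rewrite big_split /=; apply: lerD.
  rewrite -(sum_delta x1 (fun z => p t x0 z * p s x1 x1)); apply: ler_sum => y _.
  rewrite eq_sym mulrA mulrC ler_wpM2l // ler_wpM2l ?ptrans_ge0 //.
by rewrite mulr_sumr ler_sum // => y _; rewrite mulrCA.
Qed.

Section Interpolant.
Variable pi : S -> S -> R.
Hypothesis pi0 : forall x0 x1, 0 <= pi x0 x1.
Hypothesis pi1 : \sum_x0 \sum_x1 pi x0 x1 = 1.
Hypothesis pi_ac : forall x0 x1, p 1 x0 x1 = 0 -> pi x0 x1 = 0.
Notation pt := (pitilde w pi).
Notation pI := (pI w pi).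

Lemma pitilde_ge0 x0 x1 : 0 <= pt x0 x1.
Proof. by rewrite divr_ge0 // ptrans_ge0. Qed.

Lemma pitildeK x0 x1 : p 1 x0 x1 * pt x0 x1 = pi x0 x1.
Proof.
have [p0|p0] := eqVneq (p 1 x0 x1) 0; first by rewrite p0 mul0r pi_ac.
by rewrite mulrC divfK.
Qed.

(** Integration of unnormalised bridge quantities over the endpoints: a bound by [c * p 1 x0 x1]
    integrates to [c]. *)
Definition endpt (f : S -> S -> R) : R := \sum_x0 \sum_x1 f x0 x1 * pt x0 x1.

Lemma endpt_le f g : (forall x0 x1, f x0 x1 <= g x0 x1) -> endpt f <= endpt g.
Proof.
move=> fg; apply: ler_sum => x0 _; apply: ler_sum => x1 _.
by rewrite ler_wpM2r ?pitilde_ge0.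
Qed.

Lemma endptZ c f : c * endpt f = endpt (fun x0 x1 => c * f x0 x1).
Proof.
rewrite /endpt mulr_sumr; apply: eq_bigr => x0 _; rewrite mulr_sumr.
by apply: eq_bigr => x1 _; rewrite mulrA.
Qed.

Lemma endptB f g : endpt f - endpt g = endpt (fun x0 x1 => f x0 x1 - g x0 x1).
Proof.
rewrite /endpt -sumrB; apply: eq_bigr => x0 _; rewrite -sumrB.
by apply: eq_bigr => x1 _; rewrite mulrBl.
Qed.

Lemma endptD f g : endpt f + endpt g = endpt (fun x0 x1 => f x0 x1 + g x0 x1).
Proof.
rewrite /endpt -big_split; apply: eq_bigr => x0 _; rewrite -big_split.
by apply: eq_bigr => x1 _; rewrite mulrDl.
Qed.

Lemma endpt_sum (I : finType) (f : I -> S -> S -> R) :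
  \sum_i endpt (f i) = endpt (fun x0 x1 => \sum_i f i x0 x1).
Proof.
rewrite /endpt exchange_big; apply: eq_bigr => x0 _; rewrite exchange_big.
by apply: eq_bigr => x1 _; rewrite mulr_suml.
Qed.

Lemma norm_endpt f : `|endpt f| <= endpt (fun x0 x1 => `|f x0 x1|).
Proof.
apply: le_trans (ler_norm_sum _ _ _) _; apply: ler_sum => x0 _.
apply: le_trans (ler_norm_sum _ _ _) _; apply: ler_sum => x1 _.
by rewrite normrM [`|pt _ _|]ger0_norm ?pitilde_ge0.
Qed.

Lemma endpt_ge0 f : (forall x0 x1, 0 <= f x0 x1) -> 0 <= endpt f.
Proof.
by move=> f0; apply: sumr_ge0 => x0 _; apply: sumr_ge0 => x1 _; rewrite mulr_ge0 ?pitilde_ge0.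
Qed.

Lemma eq_endpt f g : (forall x0 x1, f x0 x1 = g x0 x1) -> endpt f = endpt g.
Proof. by move=> fg; apply: eq_bigr => x0 _; apply: eq_bigr => x1 _; rewrite fg. Qed.

Lemma endpt_p1 : endpt (p 1) = 1.
Proof.
rewrite -[RHS]pi1; apply: eq_bigr => x0 _; apply: eq_bigr => x1 _; exact: pitildeK.
Qed.

Lemma pIE t x : pI t x = endpt (fun x0 x1 => p t x0 x * p (1 - t) x x1).
Proof. by []. Qed.

Lemma pI_ge0 (t : R) x : 0 <= t <= 1 -> 0 <= pI t x.
Proof.
move=> /andP[t0 t1]; apply: endpt_ge0 => x0 x1.
by rewrite mulr_ge0 ?ptrans_ge0 // subr_ge0.
Qed.

Lemma pI0 x : pI 0 x = \sum_x1 pi x x1.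
Proof.
rewrite -(sum_delta x (fun x0 => \sum_x1 pi x0 x1)); apply: eq_bigr => x0 _.
rewrite mulr_sumr; apply: eq_bigr => x1 _.
rewrite subr0 /ptrans [transition _ 0 _ _]transition0 eq_sym -/(p _ _ _).
by case: eqP => [->|_]; rewrite ?mul0r // !mul1r pitildeK.
Qed.

Lemma pI_end (t : R) : 0 <= t <= 1 ->
  \sum_z `|pI t z - \sum_x0 pi x0 z| <= 2 * ((1 - t) * D).
Proof.
move=> /andP[t0 t1]; have s0 : 0 <= 1 - t by rewrite subr_ge0.
have E z : \sum_x0 pi x0 z = endpt (fun x0 x1 => (x1 == z)%:R * p 1 x0 x1).
  apply: eq_bigr => x0 _.
  rewrite -(sum_delta z (pi x0)); apply: eq_bigr => x1 _.
  by rewrite eq_sym -mulrA pitildeK.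
under eq_bigr do rewrite E pIE endptB.
apply: le_trans (ler_sum _ (fun z _ => norm_endpt _)) _.
rewrite endpt_sum; apply: (@le_trans _ _ (endpt (fun x0 x1 => 2 * ((1 - t) * D) * p 1 x0 x1))).
  apply: endpt_le => x0 x1.
  have := bridge_end x0 x1 t0 s0; rewrite subrKC => /le_trans; apply.
  by rewrite -[leRHS]mulrA ler_wpM2l // -[leRHS]mulrA ler_wpM2l // jtrans1_le.
by rewrite -endptZ endpt_p1 mulr1.
Qed.

Definition qM t (z : S) (a : jump w d m) : R := qjump (uM w pi) t z a.

(** The product [pI t z * qM t z a], written without the division by [pI t z]. *)
Definition jump_flux t (z : S) (a : jump w d m) : R :=
  endpt (fun x0 x1 => lam * (p (1 - t) (move a z) x1 * p t x0 z)).

Section Step.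
Variables t del s : R.
Hypotheses (t0 : 0 <= t) (del0 : 0 <= del) (s0 : 0 <= s).
Hypotheses (ds : 0 < del + s) (tds : 1 - t = del + s).

Let t1 : 0 <= t <= 1. Proof. by rewrite t0 /= -subr_ge0 tds ltW. Qed.
Let ds0 : 0 <= del + s. Proof. exact: ltW. Qed.
Let ds1 : del + s <= 1. Proof. by rewrite -tds gerBl. Qed.

Lemma flux_ge0 z a : 0 <= jump_flux t z a.
Proof. by apply: endpt_ge0 => x0 x1; rewrite !mulr_ge0 ?rate_ge0 ?ptrans_ge0 // tds. Qed.

Lemma sum_flux z : \sum_a jump_flux t z a =
  endpt (fun x0 x1 => p t x0 z * J1 (del + s) z x1).
Proof.
rewrite endpt_sum; apply: eq_endpt => x0 x1; rewrite tds [in RHS]/jtrans mulr_sumr.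
by apply: eq_bigr => a _; ring.
Qed.

Lemma sum_flux_le z : (del + s) * \sum_a jump_flux t z a <= D * pI t z.
Proof.
rewrite sum_flux pIE !endptZ; apply: endpt_le => x0 x1; rewrite tds.
rewrite mulrCA [leRHS]mulrCA ler_wpM2l ?ptrans_ge0 // jtrans_le //.
by rewrite ds0 ds1.
Qed.

(** Where [pI] vanishes, the total flux vanishes too by [sum_flux_le], because [del + s] is
    positive. *)
Lemma pI_qM z a : pI t z * qM t z a = jump_flux t z a.
Proof.
rewrite /qM /qjump /uM mulrCA.
have fE : jump_flux t z a = lam * endpt (fun x0 x1 => p (1 - t) (move a z) x1 * p t x0 z).
  by rewrite endptZ.
have [z0|z0] := eqVneq (pI t z) 0; last first.
  by rewrite fE; congr (_ * _); rewrite mulrC divfK.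
have := sum_flux_le z; rewrite z0 mulr0 pmulr_rle0 // (bigD1 a) //= => h.
have h' : 0 <= \sum_(i | i != a) jump_flux t z i by apply: sumr_ge0 => b _; exact: flux_ge0.
by have := flux_ge0 z a; rewrite mul0r mulr0; lra.
Qed.

Lemma pI_step_semigroup x : pI (t + del) x =
  \sum_z endpt (fun x0 x1 => p t x0 z * (p del z x * p s x x1)).
Proof.
rewrite endpt_sum pIE; apply: eq_endpt => x0 x1.
have -> : 1 - (t + del) = s by rewrite opprD addrA tds addrAC subrr add0r.
rewrite -ptrans_semigroup mulr_suml; apply: eq_bigr => z _.
by rewrite mulrA.
Qed.

(** The projected rates average the bridge rates over the endpoints given the current state, and the
    Euler step is affine in the rates, so it commutes with this averaging. *)
Lemma pI_euler z x : pI t z * euler (qM t z) del z x =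
  endpt (fun x0 x1 => p t x0 z * bridge_euler del s z x x1).
Proof.
have -> : pI t z * euler (qM t z) del z x =
    (z == x)%:R * (pI t z - del * \sum_a pI t z * qM t z a)
    + del * \sum_(a : jump w d m) (move a z == x)%:R * (pI t z * qM t z a).
  rewrite /euler -mulr_sumr.
  have -> : \sum_(a : jump w d m) (move a z == x)%:R * (pI t z * qM t z a) =
            pI t z * \sum_a qM t z a * (move a z == x)%:R.
    by rewrite mulr_sumr; apply: eq_bigr => a _; ring.
  ring.
rewrite (eq_bigr _ (fun a _ => pI_qM z a)).
have -> : \sum_(a : jump w d m) (move a z == x)%:R * (pI t z * qM t z a) =
    \sum_(a : jump w d m) endpt (fun x0 x1 =>
    (move a z == x)%:R * (lam * (p (1 - t) (move a z) x1 * p t x0 z))).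
  by apply: eq_bigr => a _; rewrite pI_qM endptZ.
rewrite sum_flux endpt_sum pIE !endptZ endptB endptZ endptD.
apply: eq_endpt => x0 x1; rewrite tds /bridge_euler.
have -> : \sum_(a : jump w d m)
     (move a z == x)%:R * (lam * (p (del + s) (move a z) x1 * p t x0 z)) =
   p t x0 z * ((\sum_(a : jump w d m) lam * (move a z == x)%:R) * p (del + s) x x1).
  rewrite mulr_suml mulr_sumr; apply: eq_bigr => a _.
  by case: eqP => [->|_]; rewrite ?mulr1n ?mulr0n; ring.
ring.
Qed.

(** Unlike the pointwise [sum_flux_le], there is no factor [1 / (1 - t)]: the sum over [z] restores
    the full time 1. *)
Lemma total_flux : \sum_z \sum_a jump_flux t z a <= D.
Proof.
under eq_bigr do rewrite sum_flux.
rewrite endpt_sum -[leRHS]mulr1 -[X in _ <= _ * X]endpt_p1 endptZ; apply: endpt_le => x0 x1.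
by rewrite ptrans_jtrans -tds subrKC jtrans1_le.
Qed.

Lemma one_step (h : R) (r : S -> jump w d m -> R) : (forall z a, 0 <= r z a) ->
  0 <= h -> del <= h * (del + s) -> del <= h ->
  \sum_x `|pI (t + del) x - \sum_z pI t z * transition (r z) del z x| <=
  6 * h * del * D ^+ 2
  + \sum_z pI t z * (2 * (del * \sum_a `|qM t z a - r z a|)
                     + 4 * (del * \sum_a `|qM t z a - r z a|) ^+ 2).
Proof.
move=> r0 h0 delhs delh.
pose F z x : R := endpt (fun x0 x1 => p t x0 z * (p del z x * p s x x1)).
pose err z : R := \sum_a `|qM t z a - r z a|.
pose J z : R := \sum_a qM t z a.
have err0 z : 0 <= err z by apply: sumr_ge0.
have bridge_part : \sum_z \sum_x `|F z x - pI t z * euler (qM t z) del z x| <=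
    2 * h * del * D ^+ 2.
  under eq_bigr do under eq_bigr do rewrite pI_euler endptB.
  apply: le_trans (ler_sum _ (fun z _ => ler_sum _ (fun x _ => norm_endpt _))) _.
  under eq_bigr do rewrite endpt_sum.
  rewrite endpt_sum -[leRHS]mulr1 -[X in _ <= _ * X]endpt_p1 endptZ; apply: endpt_le => x0 x1.
  apply: (@le_trans _ _ (\sum_z p t x0 z * (2 * (del ^+ 2 * J2 (del + s) z x1)))).
    apply: ler_sum => z _.
    under eq_bigr do rewrite -mulrBr normrM ger0_norm ?ptrans_ge0 //.
    by rewrite -mulr_sumr ler_wpM2l ?ptrans_ge0 // bridge_step.
  have -> : \sum_z p t x0 z * (2 * (del ^+ 2 * J2 (del + s) z x1)) =
            2 * del ^+ 2 * J2 1 x0 x1.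
    have -> : 1 = t + (del + s) by rewrite -tds subrKC.
    rewrite -ptrans_jtrans2 mulr_sumr; apply: eq_bigr => z _; ring.
  have := @jtrans21_le R d m w m2 x0 x1; have := ptrans_ge0 w x0 x1 (@ler01 R).
  set P := p 1 x0 x1; set JJ := J2 1 x0 x1 => P0 JJP.
  have DP : 0 <= D ^+ 2 * P by rewrite mulr_ge0 // exprn_ge0 // jbound_ge0.
  apply: (@le_trans _ _ (2 * del ^+ 2 * (D ^+ 2 * P))).
    by apply: ler_wpM2l => //; rewrite mulr_ge0 // exprn_ge0.
  rewrite -[2 * h * del * _ * _]mulrA ler_wpM2r //.
  by have := ler_wpM2r del0 delh; rewrite expr2; lra.
have frozen_part z : pI t z * \sum_x `|euler (qM t z) del z x - transition (r z) del z x| <=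
    pI t z * (2 * (del * err z) + 4 * (del * err z) ^+ 2) + 4 * h * del * D * (pI t z * J z).
  have pz0 : 0 <= pI t z by exact: pI_ge0.
  have J0 : 0 <= pI t z * J z.
    rewrite mulr_sumr; apply: sumr_ge0 => a _; rewrite pI_qM; exact: flux_ge0.
  have delJ : del * (pI t z * J z) <= h * D * pI t z.
    have JE : pI t z * J z = \sum_a jump_flux t z a.
      by rewrite mulr_sumr; apply: eq_bigr => a _; exact: pI_qM.
    have := sum_flux_le z; rewrite -JE => fl.
    apply: (@le_trans _ _ (h * ((del + s) * (pI t z * J z)))).
      by rewrite [leRHS]mulrA ler_wpM2r.
    by rewrite -mulrA ler_wpM2l.
  have [pz|pz] := eqVneq (pI t z) 0.
    by rewrite pz !mul0r mulr0 addr0.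
  have {}pz : 0 < pI t z by rewrite lt_def pz.
  have Jz0 : 0 <= J z by rewrite -(pmulr_rge0 _ pz).
  have {}delJ : del * J z <= h * D.
    by rewrite -(ler_pM2l pz) mulrCA (le_trans delJ) // mulrC.
  have -> : 4 * h * del * D * (pI t z * J z) = pI t z * (4 * (h * D) * (del * J z)) by ring.
  rewrite -mulrDr ler_wpM2l //.
  (* Nothing bounds the approximate rates themselves; they are controlled by the exact ones plus the
     gap, which is the origin of the quadratic term in the gap. *)
  have sum_r : \sum_a r z a <= J z + err z.
    rewrite -big_split; apply: ler_sum => a _ /=.
    by have := ler_norm (- (qM t z a - r z a)); rewrite normrN; lra.
  have sr0 : 0 <= \sum_a r z a by exact: sumr_ge0.
  apply: (@le_trans _ _ (2 * (del * err z) + 2 * (del * \sum_a r z a) ^+ 2)).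
    apply: le_trans (lerD (euler_lip (qM t z) (r z) z del0) (transition_euler z (r0 z) del0)).
    rewrite -big_split; apply: ler_sum => x _ /=.
    by rewrite [X in _ <= _ + X]distrC ler_distD.
  have e1 := ler_wpM2l del0 sum_r; have e2 := mulr_ge0 del0 sr0.
  have e3 := mulr_ge0 del0 Jz0; have e4 := mulr_ge0 del0 (err0 z).
  rewrite mulrDr in e1.
  have hD0 : 0 <= h * D by rewrite mulr_ge0 // jbound_ge0.
  rewrite -addrA lerD2l.
  move: e1 e2 e3 e4 delJ hD0.
  move: (del * \sum_a r z a) (del * J z) (del * err z) (h * D) => a b c k *.
  (* [2 (b + c)^2 <= 4 b^2 + 4 c^2], and [b^2 <= k b]. *)
  apply: (@le_trans _ _ (2 * (b + c) ^+ 2)); first by rewrite ler_wpM2l // ler_sqr ?nnegrE ?addr_ge0.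
  have : 0 <= (b - c) ^+ 2 by exact: sqr_ge0.
  nra.
apply: (@le_trans _ _ (\sum_z (\sum_x `|F z x - pI t z * euler (qM t z) del z x|
   + pI t z * \sum_x `|euler (qM t z) del z x - transition (r z) del z x|))).
  under [leRHS]eq_bigr do rewrite mulr_sumr -big_split /=.
  rewrite exchange_big /=; apply: ler_sum => x _.
  rewrite pI_step_semigroup -sumrB; apply: le_trans (ler_norm_sum _ _ _) _.
  apply: ler_sum => z _.
  rewrite -[X in X * `|euler _ _ _ _ - _|]ger0_norm ?pI_ge0 // -normrM mulrBr.
  exact: ler_distD.
rewrite big_split /=.
apply: le_trans (lerD bridge_part (ler_sum _ (fun z _ => frozen_part z))) _.
rewrite big_split /= -mulr_sumr.
have : \sum_z pI t z * J z <= D.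
  apply: le_trans total_flux; apply: ler_sum => z _.
  by rewrite mulr_sumr ler_sum // => a _; rewrite pI_qM.
have c0 : 0 <= 4 * h * del * D by rewrite mulr_ge0 ?jbound_ge0 // !mulr_ge0.
move=> /(ler_wpM2l c0); set X := \sum_z _ * (_ + _); set Y := \sum_z _ * J z.
by rewrite expr2; lra.
Qed.

End Step.
End Interpolant.
End Bridge.

(** * Laws at the grid times *)

Section FiniteValued.
Context {R : realType} {T : finType} (disp : measure_display)
  (Om : measurableType disp) (P : probability Om R) (X : Om -> T).
Hypothesis mX : forall z, measurable (X @^-1` [set z]).

Lemma measurable_preimage_fin (A : set T) : measurable (X @^-1` A).
Proof.
have -> : X @^-1` A = \bigcup_(z in A) X @^-1` [set z].
  by apply/seteqP; split=> [om /= ?|om [z Az] /= ->//]; exists (X om).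
by apply: fin_bigcup_measurable => //; exact: finite_finset.
Qed.

Lemma lawE z : P (X @^-1` [set z]) = (law P X z)%:E.
Proof. by rewrite /law fineK // fin_num_measure. Qed.

Lemma integral_finite_valued (B : set Om) (g : T -> R) :
  measurable B -> (forall z, 0 <= g z) ->
  (\int[P]_(om in B) (g (X om))%:E = \sum_z (g z)%:E * P (X @^-1` [set z] `&` B))%E.
Proof.
move=> mB g0.
transitivity (\int[P]_(om in B) \sum_z (g z * \1_(X @^-1` [set z]) om)%:E)%E.
  apply: eq_integral => om _; rewrite sumEFin; congr (_%:E).
  rewrite (bigD1 (X om)) //= indicE mem_set // mulr1 big1 ?addr0 // => z zX.
  by rewrite indicE memNset ?mulr0 // => /= e; rewrite e eqxx in zX.
rewrite ge0_integral_sum //; first last.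
- by move=> z om _; rewrite lee_fin mulr_ge0.
- move=> z; apply/measurable_EFinP; apply: measurable_funM; first exact: measurable_cst.
  exact: measurable_indic.
apply: eq_bigr => z _.
under eq_integral do rewrite EFinM.
rewrite ge0_integralZl_EFin //; first by rewrite integral_indic.
by apply/measurable_EFinP; exact: measurable_indic.
Qed.

Lemma prob_partition (B : set Om) : measurable B ->
  (P B = \sum_z P (X @^-1` [set z] `&` B))%E.
Proof.
move=> mB; have := @integral_finite_valued B (fun=> 1) mB (fun=> ler01).
rewrite integral_cst // mul1e => ->.
by apply: eq_bigr => z _; rewrite mul1e.
Qed.

Lemma law_ge0 z : 0 <= law P X z.
Proof. by rewrite /law fine_ge0. Qed.

Lemma law_sum1 : \sum_z law P X z = 1.
Proof.
have := prob_partition measurableT; rewrite probability_setT.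
under eq_bigr do rewrite setIT lawE.
by rewrite sumEFin => -[].
Qed.

(** [f] may take the value [+oo], as the entropy term does; any function of a finite-valued [X] is
    measurable. *)
Lemma integral_law_le (g : T -> R) (f : T -> \bar R) :
  (forall z, 0 <= g z) -> (forall z, (g z)%:E <= f z)%E ->
  ((\sum_z law P X z * g z)%:E <= \int[P]_om f (X om))%E.
Proof.
move=> g0 gf.
have -> : (\sum_z law P X z * g z)%:E = (\int[P]_om (g (X om))%:E)%E.
  rewrite integral_finite_valued // -sumEFin; apply: eq_bigr => z _.
  by rewrite setIT lawE EFinM muleC.
apply: ge0_le_integral => //.
- by move=> om _; rewrite lee_fin.
- by move=> _ Y mY; rewrite setTI; exact: (measurable_preimage_fin [set z | Y (g z)%:E]).
- by move=> _ Y mY; rewrite setTI; exact: (measurable_preimage_fin [set z | Y (f z)]).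
Qed.

End FiniteValued.

Lemma cylinder_nil (R : realType) (Om : Type) (T : eqType) (X : R -> Om -> T) :
  cylinder X [::] = setT.
Proof. by apply/seteqP; split. Qed.

Lemma cylinder_cons (R : realType) (Om : Type) (T : eqType) (X : R -> Om -> T) a l :
  cylinder X (a :: l) = X a.1 @^-1` [set a.2] `&` cylinder X l.
Proof.
apply/seteqP; split=> om /= h.
  by split=> [|b bl]; apply: h; rewrite in_cons ?eqxx // bl orbT.
by move=> b; rewrite in_cons => /orP[/eqP->|]; [exact: h.1 | exact: h.2].
Qed.

Section Grid.
Context {R : realType} (h : R).
Hypothesis h0 : 0 < h.

Lemma grid0 : grid h 0 = 0.
Proof. by rewrite /grid expr0 invr1 subrr. Qed.

Lemma grid_rest_gt0 k : 0 < 1 - grid h k.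
Proof. by rewrite /grid subKr invr_gt0 exprn_gt0 // addr_gt0. Qed.

Lemma grid_step k : grid h k.+1 - grid h k = h * (1 - grid h k.+1).
Proof.
have := grid_rest_gt0 k; rewrite /grid !subKr exprS invfM => ?.
have h1 : 1 + h != 0 by rewrite gt_eqF // addr_gt0.
rewrite opprB addrC addrA subrK.
by rewrite -[X in X - _]mul1r -mulrBl mulrA; congr (_ * _); field.
Qed.

Lemma grid_le k : grid h k <= grid h k.+1.
Proof. by rewrite -subr_ge0 grid_step mulr_ge0 ?ltW // grid_rest_gt0. Qed.

Lemma grid_homo : {homo grid h : i j / (i <= j)%N >-> i <= j}.
Proof. exact/nondecreasing_seqP/grid_le. Qed.

Lemma grid_ge0 k : 0 <= grid h k.
Proof. by rewrite -grid0 grid_homo. Qed.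

Lemma grid_lt1 k : grid h k < 1.
Proof. by rewrite -subr_gt0 grid_rest_gt0. Qed.

End Grid.

Section Generative.
Context {R : realType} (w : walk) (d m : nat) (disp : measure_display)
  (Om : measurableType disp) (P : probability Om R) (X : R -> Om -> state d m)
  (mu0 : state d m -> R) (u : R -> state d m -> state d m -> R) (h : R) (K : nat).
Hypothesis h0 : 0 < h.
Hypothesis gen : is_generative w P X mu0 u h K.

Lemma generative_measurable k z : (k <= K)%N -> measurable (X (grid h k) @^-1` [set z]).
Proof. by case: gen => mX _ _ kK; apply: mX; rewrite grid_ge0 // grid_homo. Qed.

Lemma generative_law0 z : law P (X (grid h 0)) z = mu0 z.
Proof. by case: gen => _ e _; rewrite /law grid0 e. Qed.

Lemma generative_law_step k x : (k < K)%N ->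
  law P (X (grid h k.+1)) x = \sum_z law P (X (grid h k)) z *
    transition (qjump (w := w) u (grid h k) z) (grid h k.+1 - grid h k) z x.
Proof.
move=> kK; case: gen => _ _ step.
apply: EFin_inj; rewrite -sumEFin -lawE; last by move=> z; exact: generative_measurable.
rewrite (prob_partition P (fun z => generative_measurable z (ltnW kK)));
  last exact: generative_measurable.
apply: eq_bigr => z _; rewrite EFinM -lawE; last first.
  by move=> y; apply: generative_measurable; exact: ltnW.
(* The starting time is the grid time itself and the further history is empty, so the point at [t_k]
   is listed twice and the two copies are merged. *)
have := step k (grid h k) (grid h k.+1) z z x [::] kK (lexx _) (grid_le h0 k) (lexx _).
rewrite !cylinder_cons !cylinder_nil /= !setIT setIid setIC; apply.
by move=> a; rewrite in_nil.
Qed.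

End Generative.

Section InterpolantLaw.
Context {R : realType} (w : walk) (d m : nat) (disp : measure_display)
  (Om : measurableType disp) (P : probability Om R) (X : R -> Om -> state d m)
  (pi : state d m -> state d m -> R).
Hypothesis pi0 : forall x0 x1, 0 <= pi x0 x1.
Hypothesis pi1 : \sum_x0 \sum_x1 pi x0 x1 = 1.
Hypothesis int : is_interpolant w P X pi.
Notation p := (@ptrans R w d m).

(** As division by 0 gives 0, the law of the endpoints puts no mass on a pair with [p 1 x0 x1 = 0].
    That law and [pi] both have total mass 1, so [pi] cannot charge such a pair either. *)
Lemma interpolant_ac x0 x1 : p 1 x0 x1 = 0 -> pi x0 x1 = 0.
Proof.
case: int => mX fdd p0.
have m0 z : measurable (X 0 @^-1` [set z]) by apply: mX; rewrite lexx ler01.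
have m1 z : measurable (X 1 @^-1` [set z]) by apply: mX; rewrite lexx ler01.
have tot : \sum_x0 \sum_x1 pi x0 x1 * (p 1 x0 x1 / p 1 x0 x1) = 1.
  apply: EFin_inj; rewrite -(probability_setT P) (prob_partition P m0 measurableT).
  rewrite -sumEFin; apply: eq_bigr => y0 _; rewrite setIT (prob_partition P m1 (m0 y0)).
  rewrite -sumEFin; apply: eq_bigr => y1 _.
  have := fdd y0 y1 [::]; rewrite /= !andbT ler01 => /(_ isT).
  by rewrite !cylinder_cons cylinder_nil /= setIT setIC subr0 mulr1 => ->.
have nn y0 y1 : 0 <= pi y0 y1 * (1 - p 1 y0 y1 / p 1 y0 y1).
  by rewrite mulr_ge0 //; have [->|?] := eqVneq (p 1 y0 y1) 0;
    rewrite ?mul0r ?subr0 // divff // subrr.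
have : \sum_x0 \sum_x1 pi x0 x1 * (1 - p 1 x0 x1 / p 1 x0 x1) = 0.
  transitivity (\sum_x0 \sum_x1 pi x0 x1
      - \sum_x0 \sum_x1 pi x0 x1 * (p 1 x0 x1 / p 1 x0 x1)); last by rewrite pi1 tot subrr.
  rewrite -sumrB; apply: eq_bigr => y0 _.
  by rewrite -sumrB; apply: eq_bigr => y1 _; rewrite mulrBr mulr1.
move=> /psumr_eq0P -/(_ (fun y0 _ => sumr_ge0 _ (fun y1 _ => nn y0 y1))).
move=> /(_ x0 isT) /psumr_eq0P -/(_ (fun y1 _ => nn x0 y1)) /(_ x1 isT).
by rewrite p0 mul0r subr0 mulr1.
Qed.

Lemma interpolant_law t z : 0 <= t <= 1 -> law P (X t) z = pI w pi t z.
Proof.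
move=> t01; have /andP[t0 t1] := t01; case: int => mX fdd.
have mt y : measurable (X t @^-1` [set y]) by exact: mX.
have m0 y : measurable (X 0 @^-1` [set y]) by apply: mX; rewrite lexx ler01.
have m1 y : measurable (X 1 @^-1` [set y]) by apply: mX; rewrite lexx ler01.
apply: EFin_inj; rewrite -lawE // (prob_partition P m0 (mt z)) -sumEFin.
apply: eq_bigr => x0 _.
rewrite (prob_partition P m1 (measurableI _ _ (m0 x0) (mt z))) -sumEFin.
apply: eq_bigr => x1 _.
have := fdd x0 x1 [:: (t, z)]; rewrite /= t0 t1 /= => /(_ isT).
rewrite !cylinder_cons cylinder_nil /= setIT setIA setIC subr0 mulr1 => ->.
by congr (_%:E); rewrite /pitilde; ring.
Qed.

End InterpolantLaw.

(** * Summation over the grid *)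

(** Jensen for a weight of mass at most 1, by expanding the second moment about [E]. *)
Lemma weighted_sqr_le (R : realType) (I : finType) (W x : I -> R) :
  (forall i, 0 <= W i) -> \sum_i W i <= 1 ->
  (\sum_i W i * x i) ^+ 2 <= \sum_i W i * x i ^+ 2.
Proof.
move=> W0 W1; set E := \sum_i W i * x i.
have : 0 <= \sum_i W i * (x i - E) ^+ 2.
  by apply: sumr_ge0 => i _; rewrite mulr_ge0 // sqr_ge0.
have -> : \sum_i W i * (x i - E) ^+ 2 =
    \sum_i W i * x i ^+ 2 - 2 * E * E + E ^+ 2 * \sum_i W i.
  transitivity (\sum_i (W i * x i ^+ 2 - 2 * E * (W i * x i) + E ^+ 2 * W i)).
    by apply: eq_bigr => i _; ring.
  by rewrite big_split sumrB -!mulr_sumr.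
by have := sqr_ge0 E; nra.
Qed.

Lemma sqr_sum_le (R : realType) (I : finType) (x : I -> R) :
  (\sum_i x i) ^+ 2 <= #|I|%:R * \sum_i x i ^+ 2.
Proof.
have [I0|I0] := posnP #|I|.
  by rewrite [X in X ^+ 2]big1 ?expr0n ?I0 ?mul0r // => i _;
    have := card0_eq I0 i; rewrite inE.
have N0 : 0 < #|I|%:R :> R by rewrite ltr0n.
have := @weighted_sqr_le R I (fun=> #|I|%:R^-1) x.
rewrite -!mulr_sumr exprMn => h.
have {}h : (#|I|%:R^-1) ^+ 2 * (\sum_i x i) ^+ 2 <= #|I|%:R^-1 * \sum_i x i ^+ 2.
  apply: h => [i|]; first by rewrite invr_ge0.
  by rewrite sumr_const -[X in X <= _]mulr_natr mulVf // gt_eqF.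
move: h; rewrite -(ler_pM2l (exprn_gt0 2 N0)) mulrA -exprMn mulfV ?gt_eqF //.
rewrite expr1n mul1r => /le_trans; apply.
by rewrite mulrA [#|I|%:R ^+ 2]expr2 mulfK ?gt_eqF.
Qed.

(** Stochastic kernels contract the L^1 norm, so local errors add up. The kernels are those of [b];
    [a] needs no Markov structure. *)
Lemma telescope_kernels (R : realType) (T : finType) (a b : nat -> T -> R)
    (G : nat -> T -> T -> R) (e : nat -> R) K :
  (forall x, a 0 x = b 0 x) ->
  (forall k z x, (k < K)%N -> 0 <= G k z x) ->
  (forall k z, (k < K)%N -> \sum_x G k z x = 1) ->
  (forall k x, (k < K)%N -> b k.+1 x = \sum_z b k z * G k z x) ->
  (forall k, (k < K)%N -> \sum_x `|a k.+1 x - \sum_z a k z * G k z x| <= e k) ->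
  \sum_x `|a K x - b K x| <= \sum_(k < K) e k.
Proof.
move=> ab G0 G1 bG ae.
have h n : (n <= K)%N -> \sum_x `|a n x - b n x| <= \sum_(k < n) e k.
  elim: n => [_|n IH nK].
    by rewrite big_ord0 big1 // => x _; rewrite ab subrr normr0.
  rewrite big_ord_recr /= addrC.
  apply: le_trans (lerD (ae n nK) (IH (ltnW nK))).
  have -> : \sum_x `|a n x - b n x| = \sum_x \sum_z `|a n z - b n z| * G n z x.
    rewrite exchange_big; apply: eq_bigr => z _ /=.
    by rewrite -mulr_sumr G1 // mulr1.
  rewrite -big_split; apply: ler_sum => x _ /=.
  have -> : a n.+1 x - b n.+1 x = (a n.+1 x - \sum_z a n z * G n z x)
      + \sum_z (a n z - b n z) * G n z x.
    rewrite bG // (eq_bigr _ (fun z _ => mulrBl _ _ _)) sumrB; ring.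
  apply: le_trans (ler_normD _ _) _; rewrite lerD2l.
  apply: le_trans (ler_norm_sum _ _ _) _; apply: ler_sum => z _.
  by rewrite normrM [`|G _ _ _|]ger0_norm // G0.
exact: h.
Qed.

Lemma phi_ge0 (R : realType) (a : R) : 0 <= a -> 0 <= phi a.
Proof.
rewrite le0r /phi => /predU1P[->|a0]; first by rewrite mul0r add0r subr0.
have : ln (1 + (a^-1 - 1)) <= a^-1 - 1.
  by apply: le_ln1Dx; rewrite ltrBrDl subrr invr_gt0.
rewrite subrKC lnV ?posrE // => /(ler_wpM2l (ltW a0)).
rewrite mulrBr divff ?gt_eqF // mulr1 mulrN; lra.
Qed.

Lemma bphi_ge0 (R : realType) (a b : R) : 0 <= a -> 0 <= b -> (0 <= bphi a b)%E.
Proof.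
move=> a0 b0; rewrite /bphi; case: ifP => _; first by case: ifP.
by rewrite lee_fin mulr_ge0 // phi_ge0 // divr_ge0.
Qed.

(** * From the score error to the law at the last grid time *)

Section Assembly.
Context {R : realType} (w : walk) (d m : nat).
Hypothesis m2 : (2 <= m)%N.
Variables (mu0 mu1 : state d m -> R) (pi : state d m -> state d m -> R).
Hypotheses (pmf0 : is_pmf mu0) (coupling : is_coupling mu0 mu1 pi).
Variables (h : R) (K : nat).
Hypothesis h0 : 0 < h.
Variable u : R -> state d m -> state d m -> R.
Hypothesis u0 : forall (t : R) (x y : state d m), 0 <= t <= 1 -> 0 <= u t x y.
Variables (dI : measure_display) (OmI : measurableType dI)
  (PI : probability OmI R) (XI : R -> OmI -> state d m).
Hypothesis int : is_interpolant w PI XI pi.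
Notation D := (@jbound R d m w).
Notation t_ := (grid h).
Notation N := (#|jump w d m|%:R : R).

Let pi0 x y : 0 <= pi x y. Proof. by case: coupling. Qed.
Let pi1 : \sum_x0 \sum_x1 pi x0 x1 = 1.
Proof.
case: coupling => _ e _; rewrite (eq_bigr _ (fun x _ => e x)); by case: pmf0.
Qed.
Let pi_ac := interpolant_ac pi0 pi1 int.

Let grid01 k : 0 <= t_ k <= 1.
Proof. by rewrite grid_ge0 // ltW // grid_lt1. Qed.

Definition rate_gap k (z : state d m) : R :=
  \sum_(a : jump w d m) `|qM pi (t_ k) z a - qjump u (t_ k) z a|.
Definition rate_gap2 k (z : state d m) : R :=
  \sum_(a : jump w d m) (qjump u (t_ k) z a - qM pi (t_ k) z a) ^+ 2.

Lemma qjump_ge0 k z (a : jump w d m) : 0 <= qjump u (t_ k) z a.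
Proof. by rewrite /qjump mulr_ge0 ?rate_ge0 ?u0. Qed.

Lemma qM_ge0 k z (a : jump w d m) : 0 <= qM pi (t_ k) z a.
Proof.
have /andP[t0 t1] := grid01 k.
rewrite /qM /qjump mulr_ge0 ?rate_ge0 // divr_ge0 //; last exact: pI_ge0.
apply: sumr_ge0 => x0 _; apply: sumr_ge0 => x1 _.
apply: mulr_ge0; last exact: (pitilde_ge0 w pi0).
by apply: mulr_ge0; apply: ptrans_ge0; rewrite // subr_ge0.
Qed.

Lemma rate_gap_sqr k z : rate_gap k z ^+ 2 <= N * rate_gap2 k z.
Proof.
apply: le_trans (sqr_sum_le _) _.
rewrite ler_wpM2l // ler_sum // => a _; rewrite real_normK ?num_real //.
by rewrite -sqrrN opprB.
Qed.

(** Since [bphi] is nonnegative, the integrand is at least its quadratic part. *)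
Lemma score_error_lower : ((\sum_(k < K) (t_ k.+1 - t_ k) *
  \sum_z pI w pi (t_ k) z * rate_gap2 k z)%:E <= score_error w PI XI pi u h K)%E.
Proof.
rewrite /score_error big_mkord -sumEFin; apply: lee_sum => k _.
rewrite EFinM; apply: lee_wpmul2l; first by rewrite lee_fin subr_ge0 grid_le.
have mX z : measurable (XI (t_ k) @^-1` [set z]) by case: int => mX _; exact: mX.
rewrite -(eq_bigr _ (fun z _ => congr1 ( *%R^~ (rate_gap2 k z))
  (interpolant_law int z (grid01 k)))).
apply: (integral_law_le _ mX (g := rate_gap2 k) (f := fun z =>
  (\sum_(s : jump w d m) (bphi (qjump (uM w pi) (t_ k) z s) (qjump u (t_ k) z s)
     + ((qjump u (t_ k) z s - qjump (uM w pi) (t_ k) z s) ^+ 2)%:E))%E)).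
  by move=> z; apply: sumr_ge0 => a _; exact: sqr_ge0.
move=> z; rewrite -sumEFin; apply: lee_sum => a _.
by rewrite leeDr // bphi_ge0 ?qjump_ge0 //; exact: qM_ge0.
Qed.

Section Bound.
Variable eps : R.
Hypothesis eps0 : 0 <= eps.
Hypothesis score : (score_error w PI XI pi u h K <= (eps ^+ 2)%:E)%E.
Notation A := (Num.sqrt N * eps).
Notation del k := (t_ k.+1 - t_ k).

(** A weight on pairs of a grid index and a state, of mass [t_K < 1], so that one Jensen inequality
    handles time and space together. *)
Let W (i : 'I_K * state d m) : R := del i.1 * pI w pi (t_ i.1) i.2.

Let W0 i : 0 <= W i.
Proof. by rewrite mulr_ge0 ?subr_ge0 ?grid_le // pI_ge0. Qed.

Let sumW : \sum_i W i = t_ K.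
Proof.
rewrite -(pair_bigA _ (fun (k : 'I_K) z => del k * pI w pi (t_ k) z)) /=.
transitivity (\sum_(k < K) del k); last first.
  by rewrite -(big_mkord xpredT (fun k => del k)) telescope_sumr // grid0 subr0.
apply: eq_bigr => k _; rewrite -mulr_sumr.
have mX z : measurable (XI (t_ k) @^-1` [set z]) by case: int => mX _; exact: mX.
have := law_sum1 PI mX.
rewrite (eq_bigr _ (fun z _ => interpolant_law int z (grid01 k))) => ->.
by rewrite mulr1.
Qed.

Lemma gap2_bound : \sum_i W i * rate_gap i.1 i.2 ^+ 2 <= A ^+ 2.
Proof.
rewrite exprMn sqr_sqrtr //.
have := le_trans score_error_lower score; rewrite lee_fin => /(ler_wpM2l (ler0n R #|jump w d m|)).
apply: le_trans.
rewrite mulr_sumr.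
under [leRHS]eq_bigr do rewrite !mulr_sumr.
rewrite pair_bigA /=; apply: ler_sum => -[k z] _ /=.
rewrite /W /= [leRHS]mulrCA -[leLHS]mulrA ler_wpM2l ?subr_ge0 ?grid_le //.
by rewrite [leRHS]mulrCA ler_wpM2l ?rate_gap_sqr ?(pI_ge0 w pi0).
Qed.

Lemma gap1_bound : \sum_i W i * rate_gap i.1 i.2 <= A.
Proof.
have A0 : 0 <= A by rewrite mulr_ge0 ?sqrtr_ge0.
rewrite -[leRHS]ger0_norm // -sqrtr_sqr; apply: le_trans (ler_norm _) _.
rewrite -sqrtr_sqr ler_wsqrtr //; apply: le_trans gap2_bound.
by apply: weighted_sqr_le => //; rewrite sumW ltW // grid_lt1.
Qed.

Variables (dG : measure_display) (OmG : measurableType dG)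
  (PG : probability OmG R) (XG : R -> OmG -> state d m).
Hypothesis gen : is_generative w PG XG mu0 u h K.

Lemma interpolant_generative :
  \sum_x `|pI w pi (t_ K) x - law PG (XG (t_ K)) x|
  <= 6 * h * D ^+ 2 * t_ K + 2 * A + 4 * A ^+ 2.
Proof.
pose e k := 6 * h * del k * D ^+ 2 + \sum_z pI w pi (t_ k) z *
   (2 * (del k * rate_gap k z) + 4 * (del k * rate_gap k z) ^+ 2).
have del0 k : 0 <= del k by rewrite subr_ge0 grid_le.
apply: (@le_trans _ _ (\sum_(k < K) e k)).
  apply: (@telescope_kernels _ _ (fun k => pI w pi (t_ k)) (fun k => law PG (XG (t_ k)))
    (fun k z => transition (qjump (w := w) u (t_ k) z) (del k) z)).
  - move=> x; rewrite (generative_law0 gen) grid0.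
    by rewrite (pI0 pi_ac); case: coupling.
  - by move=> k z x _; apply: transition_ge0 => // s; exact: qjump_ge0.
  - by move=> k z _; exact: transition_sum1.
  - by move=> k x kK; exact: (generative_law_step h0 gen x kK).
  - move=> k kK; have s0 := grid_rest_gt0 h0 k.+1.
    have [t0 _] := andP (grid01 k).
    have E : 1 - t_ k = del k + (1 - t_ k.+1) by ring.
    have := @one_step R d m w m2 pi pi0 pi1 pi_ac (t_ k) (del k) (1 - t_ k.+1)
      t0 (del0 k) (ltW s0) _ E h (fun z => qjump (w := w) u (t_ k) z).
    rewrite subrKC; apply.
    + by rewrite ltr_wpDl.
    + by move=> z a; exact: qjump_ge0.
    + exact: ltW.
    + by rewrite grid_step // ler_wpM2l ?(ltW h0) // lerDr -grid_step.
    + by rewrite grid_step // ler_piMr ?(ltW h0) // gerBl grid_ge0.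
apply: (@le_trans _ _ (6 * h * D ^+ 2 * \sum_i W i
    + 2 * (\sum_i W i * rate_gap i.1 i.2) + 4 * \sum_i W i * rate_gap i.1 i.2 ^+ 2)); last first.
  by have := gap1_bound; have := gap2_bound; rewrite sumW; lra.
rewrite !mulr_sumr -!big_split /= -(pair_bigA _ (fun (k : 'I_K) z =>
  6 * h * D ^+ 2 * W (k, z) + 2 * (W (k, z) * rate_gap k z)
  + 4 * (W (k, z) * rate_gap k z ^+ 2))) /=.
apply: ler_sum => k _.
have : \sum_z pI w pi (t_ k) z = 1.
  have mX z : measurable (XI (t_ k) @^-1` [set z]) by case: int => mX _; exact: mX.
  by rewrite -(law_sum1 PI mX); apply: eq_bigr => z _; rewrite (interpolant_law int).
rewrite /e => p1; rewrite -[X in X + _ <= _]mulr1 -[X in _ * X + _ <= _]p1 mulr_sumr -big_split /=.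
apply: ler_sum => z _; rewrite /W /=.
have pz0 : 0 <= pI w pi (t_ k) z by exact: pI_ge0.
(* The quadratic term carries [del k ^+ 2], while [W] contains a single factor [del k]. *)
have d1 : del k <= 1.
  have /andP[_ ?] := grid01 k.+1; have /andP[? _] := grid01 k; lra.
have : del k * (del k * (pI w pi (t_ k) z * rate_gap k z ^+ 2)) <=
    del k * (pI w pi (t_ k) z * rate_gap k z ^+ 2).
  by rewrite ler_piMl //; apply: mulr_ge0 => //; apply: mulr_ge0 => //; exact: sqr_ge0.
lra.
Qed.

Lemma generative_mu1 :
  tvdist (law PG (XG (t_ K))) mu1 <=
  (1 - t_ K) * D + 3 * h * D ^+ 2 * t_ K + A + 2 * A ^+ 2.
Proof.
have := interpolant_generative.
have := pI_end m2 pi0 pi1 pi_ac (grid01 K).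
case: coupling => _ _ e; rewrite (eq_bigr _ (fun z _ => congr1 (fun r => `|_ - r|) (e z))) => h1 h2.
have : \sum_x `|law PG (XG (t_ K)) x - mu1 x| <=
    \sum_x `|pI w pi (t_ K) x - law PG (XG (t_ K)) x| + \sum_x `|pI w pi (t_ K) x - mu1 x|.
  rewrite -big_split; apply: ler_sum => x _ /=.
  by rewrite [X in _ <= X + _]distrC ler_distD.
rewrite /tvdist; lra.
Qed.

End Bound.
End Assembly.

(** * Elementary bounds and the final constants *)

Lemma tvdist_le1 (R : realType) (T : finType) (mu nu : T -> R) :
  is_pmf mu -> is_pmf nu -> tvdist mu nu <= 1.
Proof.
move=> [mu0 mu1] [nu0 nu1].
have : \sum_x `|mu x - nu x| <= \sum_x mu x + \sum_x nu x.
  rewrite -big_split; apply: ler_sum => x _ /=.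
  by apply: le_trans (ler_normB _ _) _; rewrite !ger0_norm.
by rewrite /tvdist mu1 nu1; lra.
Qed.

Lemma ln_two_ge (R : realType) : 2^-1 <= ln 2 :> R.
Proof.
have := @le_ln1Dx R (- 2^-1); rewrite (_ : 1 + - 2^-1 = 2^-1); last by lra.
by rewrite lnV ?posrE // => /(_ _); lra.
Qed.

Lemma ln_inv_ge (R : realType) (a : R) : 0 < a -> 1 - a <= ln a^-1.
Proof.
move=> a0; have := @le_ln1Dx R (a - 1); rewrite subrKC lnV ?posrE // => /(_ _).
by rewrite ltrBrDl subrr => /(_ a0); lra.
Qed.

(** [B], [X] and [Y] stand for the early-stopping, score and discretization terms. If [X] or [Y] is
    at least 1, then [tv <= 1] suffices; otherwise [A^2 <= A <= X] and [Y^2 <= Y]. *)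
Lemma tv_arith (R : realType) (X Y A B Q tv : R) : 0 <= X -> 0 <= Y -> 0 <= A -> 0 <= B ->
  tv <= 1 -> tv <= 4 * B + Q + A + 2 * A ^+ 2 ->
  (X < 1 -> A <= X /\ A <= 1) -> Q <= 384 * Y ^+ 2 ->
  tv <= 384 * (B + X + Y).
Proof.
move=> X0 Y0 A0 B0 tv1 tvle AX QY.
have [X1|X1] := leP 1 X; first by lra.
have [Y1|Y1] := leP 1 Y; first by lra.
have [AX' A1] := AX X1.
have : A ^+ 2 <= A by rewrite expr2 ler_piMl.
have : Y ^+ 2 <= Y by rewrite expr2 ler_piMl // ltW.
by lra.
Qed.

Theorem corollary1 (R : realType) :
  exists C0 : R, 0 < C0 /\
  forall (w : walk) (d m : nat), (1 <= d)%N -> (2 <= m)%N ->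
  forall (mu0 mu1 : state d m -> R) (pi : state d m -> state d m -> R),
  is_pmf mu0 -> is_pmf mu1 -> is_coupling mu0 mu1 pi ->
  forall (eta h : R) (K : nat),
  0 < eta < 1 -> 0 < h < 1 -> grid h K = 1 - eta ->
  forall u : R -> state d m -> state d m -> R,
  (forall (t : R) (x y : state d m), 0 <= t <= 1 -> 0 <= u t x y) ->
  forall (dI : measure_display) (OmI : measurableType dI)
    (PI : probability OmI R) (XI : R -> OmI -> state d m),
  is_interpolant w PI XI pi ->
  forall (dG : measure_display) (OmG : measurableType dG)
    (PG : probability OmG R) (XG : R -> OmG -> state d m),
  is_generative w PG XG mu0 u h K ->
  forall eps : R, 0 <= eps ->
  (score_error w PI XI pi u h K <= (eps ^+ 2)%:E)%E ->
  tvdist (law PG (XG (1 - eta))) mu1 <=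
    C0 * (Cwalk R w m * d%:R * eta
          + m%:R * eta^-1
            * Num.sqrt (Num.sqrt #|jump w d m|%:R * eps + eps ^+ 2)
          + rate R w m * d%:R * m%:R
            * Num.sqrt (h * ln (m%:R * eta^-1) * ln (eta^-1))).
Proof.
(* 384 is 3 * 64 * 2: the 3 of [generative_mu1], [(4 * 2)^2] from [jbound] and [Cl], and the 2 of
   [le2]. *)
exists 384; split=> // w d m d1 m2 mu0 mu1 pi pmf0 pmf1 coupling eta h K.
move=> /andP[eta0 eta1] /andP[h0 _] gridK u u0 dI OmI PI XI int dG OmG PG XG gen eps eps0 score.
set A := Num.sqrt #|jump w d m|%:R * eps.
have A0 : 0 <= A by rewrite mulr_ge0 // sqrtr_ge0.
have m2R : 2 <= m%:R :> R by rewrite ler_nat.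
have C0 : 0 <= Cwalk R w m by case: (w) => //=.
have eta_inv : 1 < eta^-1 by rewrite invf_gt1.
have meta : 2 <= m%:R * eta^-1 by nra.
have L1 : 2^-1 <= ln (m%:R * eta^-1).
  by apply: le_trans (ln_two_ge R) _; rewrite ler_ln ?posrE //; lra.
have L2 := ln_inv_ge eta0.
have hL : 0 <= h * ln (m%:R * eta^-1) * ln eta^-1 by rewrite !mulr_ge0 //; lra.
have r0 := rate_ge0 (R := R) m w.
apply: (@tv_arith _ _ _ A _ (3 * h * jbound d m w ^+ 2 * (1 - eta))).
- by rewrite mulr_ge0 ?sqrtr_ge0 //; lra.
- by rewrite mulr_ge0 ?sqrtr_ge0 // !mulr_ge0.
- exact: A0.
- by rewrite !mulr_ge0 // ltW.
- apply: tvdist_le1 => //; rewrite -gridK.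
  have mX z : measurable (XG (grid h K) @^-1` [set z]) by exact: (generative_measurable h0 gen).
  by split=> [x|]; [exact: law_ge0 | exact: law_sum1].
- have := generative_mu1 m2 pmf0 coupling h0 u0 int eps0 score gen.
  by rewrite gridK /jbound -/A; lra.
(* As [m / eta >= 1], [r <= X < 1]; hence [A <= r^2 <= r <= X]. *)
- set r := Num.sqrt (A + _) => X1.
  have r_ge0 : 0 <= r by exact: sqrtr_ge0.
  have r2 : r ^+ 2 = A + eps ^+ 2 by rewrite sqr_sqrtr // addr_ge0 // sqr_ge0.
  have e2 := sqr_ge0 eps.
  have rX : r <= m%:R * eta^-1 * r by rewrite ler_peMl //; lra.
  by split; nra.
set s := Num.sqrt _.
have s2 : s ^+ 2 = h * ln (m%:R * eta^-1) * ln eta^-1 by rewrite sqr_sqrtr.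
(* [rate * m] is [m / 2] for NNRW, where equality holds, and 1 for URW. *)
have Cl : Cwalk R w m <= 2 * (rate R w m * m%:R).
  by case: (w) => /=; [lra | rewrite mulVf ?pnatr_eq0 -?lt0n ?(ltnW m2) //; lra].
rewrite [(_ * s) ^+ 2]exprMn s2 /jbound.
have le1 : (4 * Cwalk R w m * d%:R) ^+ 2 <= 64 * (rate R w m * d%:R * m%:R) ^+ 2.
  have -> : 64 * (rate R w m * d%:R * m%:R) ^+ 2 =
      (4 * (2 * (rate R w m * m%:R)) * d%:R) ^+ 2 by ring.
  rewrite ler_sqr ?nnegrE ?mulr_ge0 //.
  by rewrite ler_wpM2r // ler_wpM2l.
(* [2 ln (m / eta) >= 1] and [ln (1 / eta) >= 1 - eta]. *)
have le2 : h * (1 - eta) <= 2 * (h * ln (m%:R * eta^-1) * ln eta^-1).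
  have -> : 2 * (h * ln (m%:R * eta^-1) * ln eta^-1) =
     h * ((2 * ln (m%:R * eta^-1)) * ln eta^-1) by ring.
  by rewrite ler_wpM2l ?(ltW h0) //; nra.
have q0 : 0 <= (rate R w m * d%:R * m%:R) ^+ 2 by exact: sqr_ge0.
have t0 : 0 <= h * (1 - eta) by rewrite mulr_ge0 // ?(ltW h0) //; lra.
move: le1 le2 q0 t0 (sqr_ge0 (4 * Cwalk R w m * d%:R)) hL.
move: (_ ^+ 2) => a; move: (_ ^+ 2) => b; move: (h * ln _ * _) => c le1 le2 b0 t0 a0 c0.
have : (h * (1 - eta)) * a <= (2 * c) * (64 * b) by exact: ler_pM.
by lra.
Qed.
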